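(* Let $\mathcal H$ be a real or complex Hilbert space and let $T:\mathcal H\to\mathcal H$ be a positive symmetric operator with domain $\operatorname{dom}T$ (not assumed dense or closed). Then the following statements are equivalent: (i) $T$ has a positive self-adjoint extension; (ii) $\mathcal D_*(T)\subseteq\mathcal H$ is dense; (iii) $\mathcal D_*(T)^\perp\subseteq \operatorname{ran}(I+T)$; (iv) $\mathcal D_*(T)^\perp\cap\overline{\operatorname{ran}T}=\{0\}$; (v) for every sequence $(h_n)_{n\in\mathbb N}$ in $\operatorname{dom}T$ and every $f\in\mathcal H$ such that $\langle Th_n,h_n\rangle\to0$ and $Th_n\to f$, it follows that $f=0$; (vi) there exist a Hilbert space $\mathcal E$ and a densely defined linear operator $V:\mathcal H\to\mathcal E$ with $\operatorname{dom}V\supseteq\operatorname{dom}T$ such that $V(\operatorname{dom}T)^\perp=\{0\}$ (orthogonal complement in $\mathcal E$) and $$\langle Vg,Vh\rangle_{\mathcal E}=\langle g,Th\rangle,\qquad g\in\operatorname{dom}V,\ h\in\operatorname{dom}T.$$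
   Context: A linear operator $T:\mathcal H\to\mathcal K$ between Hilbert spaces (over the same field $\mathbb R$ or $\mathbb C$) is a linear map from a linear subspace $\operatorname{dom}T\subseteq\mathcal H$ into $\mathcal K$; $\operatorname{ran}T$ is its range. $T:\mathcal H\to\mathcal H$ is symmetric if $\langle Tf,g\rangle=\langle f,Tg\rangle$ for all $f,g\in\operatorname{dom}T$ (no density of the domain is required), and positive if it is symmetric and $\langle Tf,f\rangle\ge0$ for all $f\in\operatorname{dom}T$. An operator is self-adjoint if it is densely defined and equals its adjoint. For a positive symmetric operator $T:\mathcal H\to\mathcal H$, $$\mathcal D_*(T):=\Big\{g\in\mathcal H:\ \sup\{|\langle Th,g\rangle|^2: h\in\operatorname{dom}T,\ \langle Th,h\rangle\le1\}<+\infty\Big\}.$$ *)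

(* Defs.v *)
From HB Require Import structures.
From mathcomp Require Import all_boot all_order all_algebra.
From mathcomp Require Import all_classical all_reals all_analysis.
From mathcomp Require Import complex.

Set Implicit Arguments.
Unset Strict Implicit.
Unset Printing Implicit Defensive.

Import Order.TTheory GRing.Theory Num.Theory.
Import numFieldNormedType.Exports.

Local Open Scope classical_set_scope.
Local Open Scope ring_scope.

Variant scalar_kind := RealScalars | ComplexScalars.

Definition scalar_field (R : realType) (s : scalar_kind) : numFieldType :=
  match s with RealScalars => R | ComplexScalars => R[i] end.

Definition sconj (R : realType) (s : scalar_kind) : scalar_field R s -> scalar_field R s :=
  match s with
  | RealScalars => fun x : R => x
  | ComplexScalars => fun z : R[i] => z^*
  end.

Definition sRe (R : realType) (s : scalar_kind) : scalar_field R s -> R :=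
  match s with
  | RealScalars => fun x : R => x
  | ComplexScalars => fun z : R[i] => complex.Re z
  end.

(* [inner] is linear in its first argument and conjugate-linear in the second;
   over [R[i]], [0 <= z] and [z <= 1] entail that [z] is real. *)
Record hilbertType (R : realType) (s : scalar_kind) := HilbertType {
  hilbert_sort :> completeNormedModType (scalar_field R s);
  inner : {dot hilbert_sort for @sconj R s};
  inner_norm : forall x : hilbert_sort, inner x x = `|x| ^+ 2
}.

Notation "''[' x , y ]" := (inner _ x%R y%R) : ring_scope.

(* The values of [opfun] outside [dom] are irrelevant. *)
Record operator (R : realType) (s : scalar_kind) (H K : hilbertType R s) :=
  Operator {
  dom : set H;
  opfun :> H -> K;
  domT0 : dom 0;
  dom_linear : forall (a : scalar_field R s) (u v : H),
    dom u -> dom v -> dom (a *: u + v);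
  opfun_linear : forall (a : scalar_field R s) (u v : H),
    dom u -> dom v -> opfun (a *: u + v) = a *: opfun u + opfun v
}.

Section Operators.
Variables (R : realType) (s : scalar_kind).
Implicit Types H K : hilbertType R s.

Definition ran H K (T : operator H K) : set K := T @` dom T.

Definition extends H K (S T : operator H K) : Prop :=
  dom T `<=` dom S /\ forall f, dom T f -> S f = T f.

Definition symmetric_op H (T : operator H H) : Prop :=
  forall f g : H, dom T f -> dom T g -> '[T f, g] = '[f, T g].

Definition positive_op H (T : operator H H) : Prop :=
  symmetric_op T /\ forall f : H, dom T f -> 0 <= '[T f, f].

(* [S] is the adjoint of [T]; it is determined by [T] only when [dom T] is
   dense. *)
Definition is_adjoint H K (T : operator H K) (S : operator K H) : Prop :=
  dom S = [set g | exists k : H,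
             forall f : H, dom T f -> '[T f, g] = '[f, k]] /\
  forall (f : H) (g : K), dom T f -> dom S g -> '[T f, g] = '[f, S g].

Definition self_adjoint H (T : operator H H) : Prop :=
  dense (dom T) /\ is_adjoint T T.

Definition orthocompl H (A : set H) : set H :=
  [set x | forall a : H, A a -> '[x, a] = 0].

Definition Dstar H (T : operator H H) : set H :=
  [set g : H |
    (ereal_sup [set (sRe (`|'[T h, g]| ^+ 2))%:E
               | h in [set h : H | dom T h /\ '[T h, h] <= 1]%R]
     < +oo)%E].

End Operators.

(* Main.v *)
Require Import Defs.
From HB Require Import structures.
From mathcomp Require Import all_boot all_order all_algebra.
From mathcomp Require Import all_classical all_reals all_analysis.
From mathcomp Require Import complex.
From mathcomp Require Import ring lra.

Set Implicit Arguments.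
Unset Strict Implicit.
Unset Printing Implicit Defensive.

Import Order.TTheory GRing.Theory Num.Theory.
Import numFieldNormedType.Exports.

Local Open Scope classical_set_scope.
Local Open Scope ring_scope.

(* The Hilbert space of (vi) is the space [dual] of bounded antilinear
   functionals on [dom T], seminormed by [<Th, h>^(1/2)]: its inner product is
   obtained by approximating functionals by those of the form [<Tk, .>], and
   [V g] is the functional [<g, T .>], bounded exactly when [g] is in
   [Dstar T].  Condition (v) makes [Dstar T] dense because the distance of
   [(0, f)] to [{(h, Th)}] is attained along a sequence whose error has its
   second component in [Dstar T].  Given [V], the operator [V^* V^**] extends
   [T] and is positive; projecting [(0, x)] onto the graph of [V^*] shows that
   [I + V^* V^**] is onto, whence self-adjointness. *)

(** * Scalars *)

(** The obstacle is that [dom T] with the form [<Th, k>] is neither complete nor free of null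
    vectors, so the Riesz and projection theorems do not apply there. One substitute serves
    everywhere: a bounded functional is represented up to an error [1 / (n + 1)], the
    representatives are then Cauchy in the seminorm at the same rate, and a limit is taken only of
    components that lie in a complete space ([T h] in [H], the two components of a pair in [E] and
    [H], values in the scalar field). The dual is preferred to a completion of [dom T] modulo null
    vectors because equality of functionals is pointwise and their completeness comes from that of
    the scalars. The six statements are linked in a single cycle, from (i) to (vi) and back to
    (i). *)

Definition sreal (R : realType) (s : scalar_kind) : R -> scalar_field R s :=
  match s with
  | RealScalars => fun r => r
  | ComplexScalars => fun r => real_complex R r
  end.

(** Norms take values in the scalar field, which is only partially ordered over [R[i]]. Moving them
    to [R] gives a total order, where [lra] and [nra] apply. *)
Definition rnorm (R : realType) (s : scalar_kind)
  (V : normedZmodType (scalar_field R s)) (v : V) : R := sRe `|v|.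

Section Scalars.
Variables (R : realType) (s : scalar_kind).
Local Notation F := (scalar_field R s).
Implicit Types (x y z : F) (r : R).

Lemma sreal1 : sreal s 1 = 1 :> F. Proof. by case: s. Qed.

Lemma srealN r : sreal s (- r) = - sreal s r.
Proof. by case: s => //=; rewrite rmorphN. Qed.

Lemma srealM : {morph (@sreal R s) : a b / a * b}.
Proof. by move=> a b; case: s => //=; rewrite rmorphM. Qed.

Lemma sRe_real r : sRe (sreal s r) = r.
Proof. by case: s. Qed.

Lemma sReD : {morph (@sRe R s) : x y / x + y}.
Proof. by case: s => [] //= [a b] [c d]. Qed.

Lemma sRe_realM r x : sRe (sreal s r * x) = r * sRe x.
Proof. by case: s x => [] //= [a b] /=; rewrite mul0r subr0. Qed.

Lemma sReN x : sRe (- x) = - sRe x.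
Proof. by rewrite -mulN1r -sreal1 -srealN sRe_realM mulN1r. Qed.

Lemma sreal0 : sreal s 0 = 0 :> F. Proof. by case: s. Qed.

Lemma sRe0 : sRe (0 : F) = 0. Proof. by rewrite -sreal0 sRe_real. Qed.

Lemma ge0_sreal x : 0 <= x -> sreal s (sRe x) = x.
Proof. by case: s x => [] //= x x0; rewrite RRe_real// ger0_real. Qed.

Lemma ler_sreal r r' : (sreal s r <= sreal s r') = (r <= r').
Proof. by case: s => //=; rewrite lecR. Qed.

Lemma sreal_ge0 r : (0 <= sreal s r) = (0 <= r).
Proof. by rewrite -sreal0 ler_sreal. Qed.

Lemma sreal_gt0 r : (0 < sreal s r) = (0 < r).
Proof. by case: s => //=; rewrite ltcR. Qed.

Lemma ltr_sreal r r' : (sreal s r < sreal s r') = (r < r').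
Proof. by case: s => //=; rewrite ltcR. Qed.

Lemma sRe_le x y : x <= y -> sRe x <= sRe y.
Proof.
rewrite -subr_ge0 => xy; rewrite -subr_ge0 -sReN -sReD.
by rewrite -sreal_ge0 ge0_sreal.
Qed.

Lemma sRe_ge0 x : 0 <= x -> 0 <= sRe x.
Proof. by move/sRe_le; rewrite sRe0. Qed.

Lemma sconjN : {morph (@sconj R s) : x / - x}.
Proof. by case: s => [] //= x; rewrite rmorphN. Qed.

Lemma sconjM : {morph (@sconj R s) : x y / x * y}.
Proof. by case: s => [] //= x y; rewrite rmorphM. Qed.

Lemma sconjD : {morph (@sconj R s) : x y / x + y}.
Proof. by case: s => [] //= x y; rewrite rmorphD. Qed.

Lemma sconjK : involutive (@sconj R s).
Proof. by case: s => [] //= x; rewrite conjCK. Qed.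

Lemma sconj_real r : sconj (sreal s r) = sreal s r.
Proof.
case: s => //=; apply/conj_Creal.
by rewrite complex_real.
Qed.

Lemma sconj0 : sconj (0 : F) = 0. Proof. by rewrite -sreal0 sconj_real. Qed.
Lemma sconj1 : sconj (1 : F) = 1. Proof. by rewrite -sreal1 sconj_real. Qed.

Lemma mul_sconj x : x * sconj x = `|x| ^+ 2.
Proof.
case: s x => [] /= x; last by rewrite normCK.
by rewrite -expr2 -normrX ger0_norm// sqr_ge0.
Qed.

Lemma sRe_conj x : sRe (sconj x) = sRe x.
Proof.
by case: s x => [] //= x; apply: complexI; rewrite !complexRe Re_conj.
Qed.

Lemma norm_sconj x : `|sconj x| = `|x|.
Proof. by case: s x => [] //= x; rewrite norm_conjC. Qed.

Lemma sRe_le_norm x : sRe x <= rnorm x.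
Proof.
rewrite /rnorm; case: s x => [] /= x; first exact: ler_norm.
rewrite -(@lecR R) (@RRe_real _ `|x|) ?normr_real//.
by apply: le_trans (normc_ge_Re x); rewrite lecR ler_norm.
Qed.

Lemma sconj_ge0 x : 0 <= x -> sconj x = x.
Proof. by move=> x0; rewrite -(ge0_sreal x0) sconj_real. Qed.

Lemma ge0_sconjP x : sconj x = x -> 0 <= sRe x -> 0 <= x.
Proof.
case: s x => [] //= x /CrealP xr x0.
by rewrite -(RRe_real xr) ler0c.
Qed.

Section Norm.
Variable V : normedZmodType F.
Implicit Types u v w : V.

Lemma rnormE v : `|v| = sreal s (rnorm v).
Proof. by rewrite ge0_sreal. Qed.

Lemma rnorm_ge0 v : 0 <= rnorm v.
Proof. by apply: sRe_ge0. Qed.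

Lemma rnormD u v : rnorm (u + v) <= rnorm u + rnorm v.
Proof. by rewrite -sReD; apply: sRe_le; apply: ler_normD. Qed.

Lemma rnormN v : rnorm (- v) = rnorm v.
Proof. by rewrite /rnorm normrN. Qed.

Lemma rnorm0 : rnorm (0 : V) = 0.
Proof. by rewrite /rnorm normr0 sRe0. Qed.

Lemma rdistC u v : rnorm (u - v) = rnorm (v - u).
Proof. by rewrite /rnorm distrC. Qed.

Lemma rdistD w u v : rnorm (u - v) <= rnorm (u - w) + rnorm (w - v).
Proof. by rewrite -sReD; apply: sRe_le; apply: ler_distD. Qed.

Lemma rnorm_le0 v : rnorm v <= 0 -> v = 0.
Proof.
move=> v0; apply/eqP; rewrite -normr_eq0 rnormE.
suff -> : rnorm v = 0 by rewrite sreal0.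
by apply/eqP; rewrite eq_le v0 rnorm_ge0.
Qed.

End Norm.

Lemma rnormM x y : rnorm (x * y) = rnorm x * rnorm y.
Proof. by rewrite {1}/rnorm normrM rnormE sRe_realM. Qed.

Lemma rnorm_conj x : rnorm (sconj x) = rnorm x.
Proof. by rewrite /rnorm norm_sconj. Qed.

Lemma rnorm_real r : rnorm (sreal s r) = `|r|.
Proof.
rewrite /rnorm; have [r0|r0] := leP 0 r.
  by rewrite ger0_norm ?sreal_ge0// sRe_real ger0_norm.
rewrite -normrN -srealN ger0_norm ?sreal_ge0 ?oppr_ge0 ?ltW// sRe_real.
by rewrite ltr0_norm.
Qed.

Lemma rnorm_sq x : rnorm x ^+ 2 = sRe (x * sconj x).
Proof. by rewrite mul_sconj rnormE !expr2 -srealM sRe_real. Qed.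

(** Rotating an argument by this factor turns a bound on a real part into a bound on a modulus. The
    value [1] at [0] keeps the factor unimodular in every case. *)
Definition phase x : F := if x == 0 then 1 else x / `|x|.

Lemma rnorm_phase x : rnorm (phase x) = 1.
Proof.
rewrite /rnorm /phase; case: eqP => [_|/eqP x0].
  by rewrite normr1 -sreal1 sRe_real.
by rewrite normrM normfV normr_id divff ?normr_eq0// -sreal1 sRe_real.
Qed.

Lemma phaseP x : sconj (phase x) * x = `|x|.
Proof.
rewrite /phase; case: eqP => [->|/eqP x0]; first by rewrite mulr0 normr0.
rewrite sconjM -mulrA mulrC -mulrA.
have xn0 : `|x| != 0 by rewrite normr_eq0.
rewrite mul_sconj sconj_ge0 ?invr_ge0// expr2 mulrA mulVf// mul1r //.
Qed.

End Scalars.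

(** * Semi-inner products *)

(** The quadratic in [t] is largest at [t = a / p ^+ 2], where it equals [a ^+ 2 / p ^+ 2]. When
    [p = 0] it is linear in [t], and its boundedness excludes [a > 0]. *)
Lemma le_of_quadratic (R : realType) (a p e : R) : 0 <= p -> 0 <= e ->
  (forall t, 2 * (t * a) - t ^+ 2 * p ^+ 2 <= e ^+ 2) -> a <= e * p.
Proof.
move=> p0 e0 h.
have [pe0|pn0] := eqVneq p 0.
  rewrite pe0 mulr0 leNgt; apply/negP => a0.
  (* This [t] makes the linear term equal to [e ^+ 2 + 1], beyond the bound. *)
  have := h ((e ^+ 2 + 1) / (2 * a)).
  rewrite [X in _ * X](_ : _ = (e ^+ 2 + 1) / 2); last by field; lra.
  by rewrite pe0 expr0n /= mulr0 subr0; lra.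
have pgt0 : 0 < p by rewrite lt_def pn0.
have := h (a / p ^+ 2).
rewrite (_ : _ - _ = a ^+ 2 / p ^+ 2); last by field.
rewrite ler_pdivrMr ?exprn_gt0// -exprMn.
have ep0 : 0 <= e * p by apply: mulr_ge0.
by move=> hsq; rewrite leNgt; apply/negP => hlt; nra.
Qed.

Section SemiInner.
Variables (R : realType) (s : scalar_kind).
Local Notation F := (scalar_field R s).
Variable X : lmodType F.

Record linear_set (D : set X) : Prop := LinearSet {
  linear_set0 : D 0;
  linear_setP : forall (a : F) u v, D u -> D v -> D (a *: u + v)
}.

(** Laws relative to a subset, without definiteness, let one theory cover the inner products of
    Hilbert spaces, the form of [T] on [dom T], and the forms on graphs. *)
Record semi_inner (D : set X) (B : X -> X -> F) : Prop := SemiInner {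
  semi_inner_linear_set : linear_set D;
  semi_innerPl : forall a u v w, D u -> D v -> D w ->
    B (a *: u + v) w = a * B u w + B v w;
  semi_innerC : forall u v, D u -> D v -> B u v = sconj (B v u);
  semi_inner_ge0 : forall u, D u -> 0 <= B u u
}.

Definition antilinear (D : set X) (l : X -> F) : Prop :=
  forall a u v, D u -> D v -> l (a *: u + v) = sconj a * l u + l v.

Section LinearSet.
Variables (D : set X) (sD : linear_set D).

Lemma linear_setZ a u : D u -> D (a *: u).
Proof.
move=> Du; rewrite -[_ *: _]addr0; apply: (linear_setP sD) => //.
exact: linear_set0.
Qed.

Lemma linear_setD u v : D u -> D v -> D (u + v).
Proof. by move=> Du Dv; rewrite -[u]scale1r; apply: (linear_setP sD). Qed.

Lemma linear_setB u v : D u -> D v -> D (u - v).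
Proof. by move=> Du Dv; rewrite addrC -scaleN1r; apply: (linear_setP sD). Qed.

Variables (l : X -> F) (al : antilinear D l).

Lemma antilinear0 : l 0 = 0.
Proof.
have := al 1 (linear_set0 sD) (linear_set0 sD).
rewrite scale1r add0r sconj1 mul1r => /eqP.
by rewrite addrC -subr_eq subrr eq_sym => /eqP.
Qed.

Lemma antilinearZ a u : D u -> l (a *: u) = sconj a * l u.
Proof.
by move=> Du; rewrite -[_ *: _]addr0 al ?antilinear0 ?addr0//; exact: linear_set0.
Qed.

Lemma antilinearD u v : D u -> D v -> l (u + v) = l u + l v.
Proof. by move=> Du Dv; rewrite -[u in LHS]scale1r al// sconj1 mul1r. Qed.

Lemma antilinearB u v : D u -> D v -> l (u - v) = l u - l v.
Proof.
move=> Du Dv; rewrite addrC -scaleN1r al//.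
by rewrite sconjN sconj1 mulN1r addrC.
Qed.

End LinearSet.

Section Theory.
Variables (D : set X) (B : X -> X -> F) (hB : semi_inner D B).
Let sD : linear_set D := semi_inner_linear_set hB.

Definition seminorm u : R := Num.sqrt (sRe (B u u)).
Local Notation p := seminorm.

Lemma seminorm_ge0 u : 0 <= p u.
Proof. exact: sqrtr_ge0. Qed.

Lemma seminorm_sq u : D u -> p u ^+ 2 = sRe (B u u).
Proof. by move=> Du; rewrite sqr_sqrtr// sRe_ge0// (semi_inner_ge0 hB). Qed.

Lemma semi_innerE u : D u -> B u u = sreal s (p u ^+ 2).
Proof. by move=> Du; rewrite seminorm_sq// ge0_sreal// (semi_inner_ge0 hB). Qed.

Lemma semi_innerPr w : D w -> antilinear D (B w).
Proof.
move=> Dw a u v Du Dv.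
rewrite (semi_innerC hB)//; last exact: (linear_setP sD).
rewrite (semi_innerPl hB)// sconjD sconjM.
by rewrite -(semi_innerC hB)// -(semi_innerC hB).
Qed.

Lemma semi_innerBl u v w : D u -> D v -> D w -> B (u - v) w = B u w - B v w.
Proof.
by move=> Du Dv Dw; rewrite addrC -scaleN1r (semi_innerPl hB)// mulN1r addrC.
Qed.

Lemma semi_innerBr w u v : D w -> D u -> D v -> B w (u - v) = B w u - B w v.
Proof. by move=> Dw; apply: antilinearB => //; exact: semi_innerPr. Qed.

Lemma seminormZ a u : D u -> p (a *: u) = rnorm a * p u.
Proof.
move=> Du; apply/eqP; rewrite -(@eqrXn2 _ 2)// ?mulr_ge0 ?seminorm_ge0 ?rnorm_ge0//.
have Dau := linear_setZ sD a Du.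
rewrite seminorm_sq// exprMn seminorm_sq// -[a *: u in X in B X _]addr0.
rewrite (semi_innerPl hB)//; last exact: linear_set0.
have -> : B 0 (a *: u) = 0.
  by rewrite -(subrr u) semi_innerBl// subrr.
rewrite addr0 (antilinearZ sD)//; last exact: semi_innerPr.
rewrite mulrA rnorm_sq semi_innerE// -[_ * sconj a]ge0_sreal ?mul_sconj ?exprn_ge0//.
by rewrite -srealM !sRe_real.
Qed.

(** Testing on the real multiples [t u] bounds the real part of [w u] through [le_of_quadratic],
    null vectors included; rotating [u] by the phase of [w u] then gives the modulus. *)
Lemma antilinear_bound (w : X -> F) e : antilinear D w -> 0 <= e ->
  (forall u, D u -> 2 * sRe (w u) - p u ^+ 2 <= e ^+ 2) ->
  forall u, D u -> rnorm (w u) <= e * p u.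
Proof.
move=> aw e0 h u Du.
have re v : D v -> sRe (w v) <= e * p v.
  move=> Dv; apply: le_of_quadratic => //; first exact: seminorm_ge0.
  move=> t; have := h _ (linear_setZ sD (sreal s t) Dv).
  rewrite (antilinearZ sD)// sconj_real sRe_realM seminormZ// rnorm_real.
  by rewrite exprMn real_normK ?num_real.
have := re _ (linear_setZ sD (phase (w u)) Du).
by rewrite (antilinearZ sD)// phaseP seminormZ// rnorm_phase mul1r.
Qed.

Lemma seminorm_sqB u v : D u -> D v ->
  p (u - v) ^+ 2 = p u ^+ 2 - 2 * sRe (B u v) + p v ^+ 2.
Proof.
move=> Du Dv; have Duv := linear_setB sD Du Dv.
rewrite !seminorm_sq// semi_innerBl// !semi_innerBr//.
rewrite [B v u](semi_innerC hB)// !(sReD, sReN) sRe_conj; ring.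
Qed.

(** Expanding [p (u - w) ^+ 2 >= 0] is exactly the hypothesis of [antilinear_bound] for [B u] with
    [e = p u]. *)
Lemma cauchy_schwarz u v : D u -> D v -> rnorm (B u v) <= p u * p v.
Proof.
move=> Du Dv; apply: antilinear_bound => //.
- exact: semi_innerPr.
- exact: seminorm_ge0.
- move=> w Dw; have := seminorm_sqB Du Dw.
  by have := sqr_ge0 (p (u - w)); lra.
Qed.

Lemma seminormN u : D u -> p (- u) = p u.
Proof.
move=> Du; rewrite -scaleN1r seminormZ// rnormN /rnorm normr1.
by rewrite -(sreal1 R s) sRe_real mul1r.
Qed.

Lemma seminormB u v : D u -> D v -> p (u - v) <= p u + p v.
Proof.
move=> Du Dv; rewrite -(@ler_pXn2r _ 2)// ?nnegrE ?addr_ge0 ?seminorm_ge0//.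
rewrite seminorm_sqB// sqrrD.
have := cauchy_schwarz Du Dv; have := sRe_le_norm (- B u v).
by rewrite rnormN sReN => h1 h2; lra.
Qed.

Lemma seminormD u v : D u -> D v -> p (u + v) <= p u + p v.
Proof.
move=> Du Dv; have DNv : D (- v) by rewrite -scaleN1r; exact: linear_setZ.
by rewrite -[v in u + v]opprK -[p v]seminormN//; apply: seminormB.
Qed.

(* The functional [2 Re l - p^2] is bounded above by [C^2]; a point where it
   comes within [e^2] of its supremum represents [l] up to [e] in the dual
   norm.  This replaces the Riesz theorem when [D] is not complete. *)
Lemma approx_riesz (l : X -> F) C : antilinear D l ->
  (forall u, D u -> rnorm (l u) <= C * p u) ->
  forall e, 0 < e -> exists2 h, D h &
    forall u, D u -> rnorm (l u - B h u) <= e * p u.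
Proof.
move=> al lC e e0.
pose J u := 2 * sRe (l u) - p u ^+ 2.
have J_le u : D u -> J u <= C ^+ 2.
  move=> Du; rewrite /J; have := lC _ Du; have := sRe_le_norm (l u) => h1 h2.
  by have := sqr_ge0 (C - p u); lra.
have hs : has_sup (J @` D).
  split; first by exists (J 0), 0 => //; exact: linear_set0.
  by exists (C ^+ 2) => _ [u Du <-]; exact: J_le.
have [_ [h Dh <-] hJ] := sup_adherent (exprn_gt0 2 e0) hs.
exists h => // u Du; apply: (@antilinear_bound (fun v => l v - B h v)) => //; last 2 first.
- exact: ltW.
- move=> {Du}u Du; have Dhu := linear_setD sD Dh Du.
  have : J (h + u) <= sup (J @` D) by apply: sup_upper_bound => //; exists (h + u).
  have DNu : D (- u) by rewrite -scaleN1r; exact: linear_setZ.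
  have := seminorm_sqB Dh DNu; rewrite opprK seminormN//.
  have := semi_innerBr Dh (linear_set0 sD) Du.
  rewrite sub0r (antilinear0 sD (semi_innerPr Dh)) sub0r => ->.
  move: hJ; rewrite /J (antilinearD al)// !(sReD, sReN) => + ->; lra.
- move=> a v w Dv Dw; rewrite al// (semi_innerPr Dh)// mulrBr; ring.
Qed.

(** Taking [u = w] gives [p w ^+ 2 <= e * p w]. Closeness of functionals [B w] in the dual norm thus
    becomes closeness of their representatives. *)
Lemma seminorm_le_dual w e : D w -> 0 <= e ->
  (forall u, D u -> rnorm (B w u) <= e * p u) -> p w <= e.
Proof.
move=> Dw e0 /(_ w Dw); rewrite semi_innerE// rnorm_real ger0_norm ?sqr_ge0//.
by have := seminorm_ge0 w => pw h; rewrite leNgt; apply/negP => lt; nra.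
Qed.

End Theory.
End SemiInner.

(** * Convergence with a rate *)

Definition rate (R : realType) (n : nat) : R := n.+1%:R^-1.

Section Rate.
Variable R : realType.
Local Notation rate := (rate R).

Lemma rate_gt0 n : 0 < rate n.
Proof. by rewrite invr_gt0 ltr0n. Qed.

Lemma rate_anti m n : (m <= n)%N -> rate n <= rate m.
Proof. by move=> mn; rewrite lef_pV2 ?posrE ?ltr0n// ler_nat. Qed.

Lemma rate0 : rate 0 = 1.
Proof. by rewrite /rate invr1. Qed.

Lemma rate_le1 n : rate n <= 1.
Proof. by rewrite -rate0; exact: rate_anti. Qed.

Lemma rate_lt (C e : R) : 0 < e -> exists N, forall n, (N <= n)%N -> C * rate n < e.
Proof.
move=> e0; have C1 : 0 < `|C| + 1 by rewrite ltr_wpDl.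
have e'0 : 0 < e / (`|C| + 1) by rewrite divr_gt0.
have [N _ hN] := near_infty_natSinv_lt (PosNum e'0).
exists N => n /hN /=; rewrite ltr_pdivlMr// mulrC; apply: le_lt_trans.
by rewrite ler_pM2r ?rate_gt0//; have := ler_norm C; lra.
Qed.

Lemma le_rate (C x y : R) : (forall n, x <= y + C * rate n) -> x <= y.
Proof.
move=> h; rewrite leNgt; apply/negP => xy.
have [|N /(_ _ (leqnn N)) hN] := @rate_lt C (x - y); first by rewrite subr_gt0.
by have := h N; lra.
Qed.

End Rate.

Section Convergence.
Variables (R : realType) (s : scalar_kind).
Local Notation F := (scalar_field R s).

Lemma cvg_rate (V : pseudoMetricNormedZmodType F) (u : nat -> V) (l : V) C :
  (forall n, rnorm (u n - l) <= C * rate R n) -> u n @[n --> \oo] --> l.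
Proof.
move=> h; apply/cvgrPdist_lt => e e0.
have e'0 : 0 < sRe e by rewrite -(sreal_gt0 s) ge0_sreal// ltW.
have [N hN] := rate_lt C e'0.
exists N => // n /= /hN hn.
by rewrite -(ge0_sreal (ltW e0)) rnormE ltr_sreal rdistC; apply: le_lt_trans hn.
Qed.

Lemma cvg_rnorm_lt (V : pseudoMetricNormedZmodType F) (u : nat -> V) (l : V) :
  u n @[n --> \oo] --> l ->
  forall (e : R) m, 0 < e -> exists2 n, (m <= n)%N & rnorm (u n - l) < e.
Proof.
move=> /cvgrPdist_lt h e m e0.
have := h (sreal s e); rewrite sreal_gt0 => /(_ e0) [N _ hN].
exists (maxn m N); first exact: leq_maxl.
have := hN (maxn m N) (leq_maxr _ _).
by rewrite /= rnormE ltr_sreal rdistC.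
Qed.

(** The limit must keep the constant [C] of the Cauchy bound, so that errors can be tracked through
    successive limits by real inequalities. *)
Definition rate_complete (V : normedZmodType F) : Prop :=
  forall (u : nat -> V) (C : R), 0 <= C ->
  (forall n m, rnorm (u n - u m) <= C * (rate R n + rate R m)) ->
  exists l, forall n, rnorm (u n - l) <= C * rate R n.

Lemma rate_complete_completeNormedMod (V : completeNormedModType F) :
  rate_complete V.
Proof.
move=> u C C0 h.
have /cauchy_cvgP /cvg_ex[l ul] : cauchy (u n @[n --> \oo]).
  apply: cauchy_exP => e e0.
  have e'0 : 0 < sRe e by rewrite -(sreal_gt0 s) ge0_sreal// ltW.
  have [N hN] := rate_lt (C * 2) e'0.
  exists (u N), N => // n /= Nn; rewrite -ball_normE /ball_ /=.
  rewrite -(ge0_sreal (ltW e0)) rnormE ltr_sreal.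
  apply: le_lt_trans (hN _ (leqnn N)); apply: le_trans (h _ _) _.
  by rewrite -mulrA ler_wpM2l//; have := rate_anti R Nn; lra.
(* The vanishing error is [C * rate m] from the Cauchy bound, with [m >= k], plus [rate k] for the
   distance from [u m] to the limit. *)
exists l => n; apply: (@le_rate _ (C + 1)) => k.
have [m km hm] := cvg_rnorm_lt ul k (rate_gt0 R k).
apply: le_trans (rdistD (u m) _ _) _.
apply: le_trans (lerD (h n m) (ltW hm)) _.
by have := ler_wpM2l C0 (rate_anti R km); lra.
Qed.

End Convergence.

(** Over [R[i]], real and imaginary parts converge separately, which alone would double the
    constant; comparing [u n] with a far term [u m] first restores [C]. *)
Lemma rate_complete_scalar (R : realType) (s : scalar_kind) :
  rate_complete (scalar_field R s).
Proof.
case: s => u C C0 h.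
  exact: (@rate_complete_completeNormedMod R RealScalars R).
have reC := @rate_complete_completeNormedMod R RealScalars R.
have normE (r : R) : @rnorm R RealScalars R r = `|r| by [].
pose re n := complex.Re (u n).
pose im n := complex.Im (u n).
have nrmE (z : R[i]) : (@rnorm R ComplexScalars _ z)%:C%C = `|z|.
  exact/esym/(@rnormE R ComplexScalars).
have nrm_i : @rnorm R ComplexScalars _ ('i)%C = 1.
  by rewrite /rnorm normc_def /= expr0n expr1n add0r sqrtr1.
have le_re (z : R[i]) : `|complex.Re z| <= @rnorm R ComplexScalars _ z.
  by rewrite -(@lecR R) nrmE; exact: normc_ge_Re.
have le_im (z : R[i]) : `|complex.Im z| <= @rnorm R ComplexScalars _ z.
  have := le_re (z * 'i%C); rewrite ReiNIm normrN => /le_trans; apply.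
  by rewrite (@rnormM R ComplexScalars) nrm_i mulr1.
have [a ha] : exists l, forall n, `|re n - l| <= C * rate R n.
  apply: (reC re C C0) => n m; apply: le_trans (h n m).
  by rewrite normE -raddfB; exact: le_re.
have [b hb] : exists l, forall n, `|im n - l| <= C * rate R n.
  apply: (reC im C C0) => n m; apply: le_trans (h n m).
  by rewrite normE -raddfB; exact: le_im.
(* One [C] comes from the Cauchy bound, two from the errors of the real and imaginary parts at
   [m]. *)
exists (Complex a b) => n; apply: (@le_rate _ (3 * C)) => m.

apply: le_trans (rdistD (u m) _ _) _.
have : @rnorm R ComplexScalars _ (u m - Complex a b) <= 2 * C * rate R m.
  have -> : u m - Complex a b = (re m - a)%:C%C + 'i%C * (im m - b)%:C%C.
    by rewrite /re /im; case: (u m) => x y; simpc.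
  apply: le_trans (rnormD _ _) _.
  have -> : @rnorm R ComplexScalars _ ((re m - a)%:C)%C = `|re m - a|.
    exact: (@rnorm_real R ComplexScalars).
  rewrite (@rnormM R ComplexScalars).
  have -> : @rnorm R ComplexScalars _ ((im m - b)%:C)%C = `|im m - b|.
    exact: (@rnorm_real R ComplexScalars).
  rewrite nrm_i.
  by have := ha m; have := hb m; lra.
by have := h n m; lra.
Qed.

(** * Hilbert spaces *)

Section RieszSequence.
Variables (R : realType) (s : scalar_kind).
Local Notation F := (scalar_field R s).
Variables (X : lmodType F) (D : set X) (B : X -> X -> F).
Hypothesis hB : semi_inner D B.
Let sD := semi_inner_linear_set hB.

(** The functionals [B (h n)] and [B (h m)] both approximate [l], so their difference is small in
    the dual norm, and [seminorm_le_dual] makes [h] Cauchy. This stands in for an orthogonal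
    projection. *)
Lemma riesz_sequence (l : X -> F) C : antilinear D l ->
  (forall u, D u -> rnorm (l u) <= C * seminorm B u) ->
  exists h : nat -> X, [/\ forall n, D (h n),
    forall n u, D u -> rnorm (l u - B (h n) u) <= rate R n * seminorm B u &
    forall n m, seminorm B (h n - h m) <= rate R n + rate R m].
Proof.
move=> al lC.
have /choice[h hP] n : exists h, D h /\
    forall u, D u -> rnorm (l u - B h u) <= rate R n * seminorm B u.
  by have [h] := approx_riesz hB al lC (rate_gt0 R n); exists h.
exists h; split=> [n|n|n m]; [exact: (hP n).1|exact: (hP n).2|].
have [[Dn hn] [Dm hm]] := (hP n, hP m).
apply: (seminorm_le_dual hB); first exact: linear_setB.
  by rewrite addr_ge0 ?ltW ?rate_gt0.
move=> u Du; rewrite (semi_innerBl hB)// mulrDl.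
apply: le_trans (rdistD (l u) _ _) _.
by rewrite rdistC lerD ?hn ?hm.
Qed.

End RieszSequence.

Lemma semi_inner_sub (R : realType) (s : scalar_kind)
    (X : lmodType (scalar_field R s)) (D : set X) B (A : set X) :
  semi_inner D B -> linear_set A -> A `<=` D -> semi_inner A B.
Proof.
move=> hB sA AD; split=> //.
- by move=> a u v w /AD Du /AD Dv /AD Dw; exact: (semi_innerPl hB).
- by move=> u v /AD Du /AD Dv; exact: (semi_innerC hB).
- by move=> u /AD Du; exact: (semi_inner_ge0 hB).
Qed.

Section Hilbert.
Variables (R : realType) (s : scalar_kind) (H : hilbertType R s).
Local Notation F := (scalar_field R s).
Implicit Types (x y z : H) (A : set H).

Lemma inner_semi_inner : semi_inner [set: H] (inner H).
Proof.
split=> //.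
- move=> a u v w _ _ _; exact: linearPl.
- by move=> u v _ _; rewrite hermitian_subproof expr0 mul1r.
- by move=> u _; rewrite inner_norm exprn_ge0.
Qed.

Lemma innerBl x y z : '[x - y, z] = '[x, z] - '[y, z].
Proof. exact: (semi_innerBl inner_semi_inner). Qed.

Lemma innerBr x y z : '[x, y - z] = '[x, y] - '[x, z].
Proof. exact: (semi_innerBr inner_semi_inner). Qed.

Lemma innerDl x y z : '[x + y, z] = '[x, z] + '[y, z].
Proof. by rewrite -[x]scale1r (semi_innerPl inner_semi_inner)// mul1r scale1r. Qed.

Lemma innerDr x y z : '[x, y + z] = '[x, y] + '[x, z].
Proof. exact: (antilinearD (semi_innerPr inner_semi_inner (I : [set: H] x))). Qed.

Lemma inner_conj x y : '[x, y] = sconj '[y, x].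
Proof. exact: (semi_innerC inner_semi_inner). Qed.

Lemma inner_seminorm x : seminorm (inner H) x = rnorm x.
Proof.
by rewrite /seminorm inner_norm rnormE expr2 -srealM sRe_real -expr2 sqrtr_sqr
  ger0_norm ?rnorm_ge0.
Qed.

Lemma inner_rnorm x : '[x, x] = sreal s (rnorm x ^+ 2).
Proof. by rewrite (semi_innerE inner_semi_inner)// inner_seminorm. Qed.

Lemma inner_cauchy_schwarz x y : rnorm '[x, y] <= rnorm x * rnorm y.
Proof. by rewrite -!inner_seminorm; exact: (cauchy_schwarz inner_semi_inner). Qed.

Lemma inner_eq0 x : '[x, x] = 0 -> x = 0.
Proof.
rewrite inner_norm => /eqP; rewrite expf_eq0 /= normr_eq0.
by move/eqP.
Qed.

Lemma open_rball (O : set H) x : open O -> O x ->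
  exists2 e : R, 0 < e & forall y, rnorm (x - y) < e -> O y.
Proof.
move=> oO Ox; have /nbhs_ballP[e /= e0 he] := open_nbhs_nbhs (conj oO Ox).
exists (sRe e); first by rewrite -(sreal_gt0 s) ge0_sreal// ltW.
move=> y xy; apply: he; rewrite -ball_normE /ball_ /= -(ge0_sreal (ltW e0)).
by rewrite rnormE ltr_sreal.
Qed.

Lemma dense_rate A x n : dense A -> exists2 a, A a & rnorm (x - a) < rate R n.
Proof.
move=> dA; pose e := sreal s (rate R n).
have e0 : 0 < e by rewrite sreal_gt0 rate_gt0.
have : (ball x e)^° !=set0 by exists x; exact: nbhsx_ballx.
move=> /dA /(_ (open_interior _)) [a [/interior_subset xa Aa]]; exists a => //.
by move: xa; rewrite -ball_normE /ball_ /= rnormE ltr_sreal.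
Qed.

Lemma dense_orthocompl A x : dense A -> (forall a, A a -> '[x, a] = 0) -> x = 0.
Proof.
move=> dA xA; apply: inner_eq0; apply: rnorm_le0.
apply: (@le_rate _ (rnorm x)) => n; rewrite add0r.
have [a Aa xa] := dense_rate x n dA.
rewrite -[X in rnorm X]subr0 -(xA _ Aa) -innerBr.
by apply: le_trans (inner_cauchy_schwarz _ _) _; rewrite ler_wpM2l ?rnorm_ge0// ltW.
Qed.

(** The functional [<x, .>] on [A] has a Riesz sequence in [A], which converges in [H] to some [l].
    Then [x - l] is orthogonal to [A], so [x = l] is a limit of points of [A]. *)
Lemma orthocompl_dense A : linear_set A ->
  (forall x, (forall a, A a -> '[x, a] = 0) -> x = 0) -> dense A.
Proof.
move=> sA A0 O [x Ox] oO.
have hA := semi_inner_sub inner_semi_inner sA (@subsetT _ _).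
have [h [Ah xh hh]] : exists h : nat -> H, [/\ forall n, A (h n),
    forall n u, A u -> rnorm ('[x, u] - '[h n, u]) <= rate R n * seminorm (inner H) u &
    forall n m, seminorm (inner H) (h n - h m) <= rate R n + rate R m].
  apply: (riesz_sequence hA (C := rnorm x)).
    by move=> a u v _ _; rewrite (semi_innerPr inner_semi_inner).
  by move=> u _; rewrite inner_seminorm; exact: inner_cauchy_schwarz.
have [||l hl] := @rate_complete_completeNormedMod R s H h 1 => //.
  by move=> n m; rewrite mul1r -inner_seminorm.
have {}hl n : rnorm (h n - l) <= rate R n by have := hl n; rewrite mul1r.
have xl : x = l.
  apply/eqP; rewrite -subr_eq0; apply/eqP; apply: A0 => a Aa.
  apply: rnorm_le0; apply: (@le_rate _ (2 * rnorm a)) => n.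
  rewrite innerBl; apply: le_trans (rdistD '[h n, a] _ _) _.
  have := xh n a Aa; rewrite inner_seminorm.
  have := inner_cauchy_schwarz (h n - l) a; rewrite innerBl.
  have := ler_wpM2r (rnorm_ge0 a) (hl n).
  by lra.
have [e e0 he] := open_rball oO Ox.
have [N hN] := rate_lt 1 e0.
exists (h N); split=> //; apply: he; rewrite rdistC xl.
by apply: le_lt_trans (hl N) _; have := hN _ (leqnn N); rewrite mul1r.
Qed.

End Hilbert.

(** * The dual of a semi-inner product space *)

(** Choose centres [u n] of balls of radius [rate n] that belong to the filter. Any two such balls
    meet, so [u] is Cauchy with constant [1], and the filter follows its limit. *)
Lemma rate_complete_cauchy_cvg (R : realType) (s : scalar_kind)
    (V : normedModType (scalar_field R s)) :
  rate_complete V -> forall G : set_system V, ProperFilter G -> cauchy G -> cvg G.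
Proof.
move=> cV G PG /cauchyP cG.
have /choice[u uP] n : exists u : V, G (ball u (sreal s (rate R n))).
  by apply: cG; rewrite sreal_gt0 rate_gt0.
have uG n : G [set x | rnorm (u n - x) < rate R n].
  apply: filterS (uP n) => x; rewrite -ball_normE /ball_ /=.
  by rewrite rnormE ltr_sreal.
have [//|n m|l hl] := cV u 1.
  have [x [/= xn xm]] := filter_ex (filterI (uG n) (uG m)).
  rewrite mul1r (le_trans (rdistD x _ _))// (rdistC x) lerD// ltW//.
apply/cvg_ex; exists l => A /nbhs_ballP[e /= e0 he].
have e'0 : 0 < sRe e by rewrite -(sreal_gt0 s) ge0_sreal// ltW.
have [N /(_ _ (leqnn N)) hN] := rate_lt 2 e'0.
apply: filterS (uG N) => x ux; apply: he; rewrite -ball_normE /ball_ /=.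
rewrite -(ge0_sreal (ltW e0)) rnormE ltr_sreal.
apply: le_lt_trans (rdistD (u N) _ _) _; rewrite rdistC.
have lN := hl N; rewrite mul1r in lN.
apply: le_lt_trans hN; rewrite mulr_natl mulr2n; apply: lerD => //.
exact/ltW.
Qed.

Section Dual.
Variables (R : realType) (s : scalar_kind).
Local Notation F := (scalar_field R s).
Variables (X : lmodType F) (D : set X) (B : X -> X -> F).
Hypothesis hB : semi_inner D B.
Let sD := semi_inner_linear_set hB.
Local Notation p := (seminorm B).

Definition bounded_antilinear (f : X -> F) : Prop :=
  antilinear D f /\ exists C, forall u, D u -> rnorm (f u) <= C * p u.

(** Vanishing off [D] selects one function for each functional on [D], so that agreement on [D] is
    equality and no quotient is taken. *)
Definition dual_pred : {pred X -> F^o} :=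
  [pred f | `[< bounded_antilinear f /\ forall u, ~ D u -> f u = 0 >]].

Lemma dual_submod_closed : submod_closed dual_pred.
Proof.
split.
  apply/asboolP; split=> //; split.
    by move=> a u v _ _; rewrite -![RHS]/(sconj a * 0 + 0) mulr0 addr0.
  by exists 0 => u _; rewrite mul0r -[X in rnorm X]/(0 : F) rnorm0.
move=> a f g /asboolP[[fa [Cf fb]] f0] /asboolP[[ga [Cg gb]] g0].
apply/asboolP; split; last first.
  by move=> u Du; rewrite !fctE f0// g0// scaler0 addr0.
split.
  move=> b u v Du Dv; rewrite !fctE fa// ga// /GRing.scale /=; ring.
exists (rnorm a * Cf + Cg) => u Du; rewrite !fctE.
apply: le_trans (rnormD _ _) _; rewrite rnormM mulrDl lerD// ?gb//.
by rewrite -mulrA ler_wpM2l ?rnorm_ge0// fb.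
Qed.

HB.instance Definition _ :=
  GRing.isSubmodClosed.Build F (X -> F^o) dual_pred dual_submod_closed.

(* [hB] is a parameter so that it is available to the norm instance below. *)
Definition dual of semi_inner D B := {f : X -> F^o | f \in dual_pred}.
Local Notation E := (dual hB).

HB.instance Definition _ := SubType.copy E {f : X -> F^o | f \in dual_pred}.
HB.instance Definition _ := [Choice of E by <:].
HB.instance Definition _ := [SubChoice_isSubLmodule of E by <:].

End Dual.

(** * Inner product and completeness of the dual *)

Section DualInner.
Variables (R : realType) (s : scalar_kind).
Local Notation F := (scalar_field R s).
Variables (X : lmodType F) (D : set X) (B : X -> X -> F).
Variable hB : semi_inner D B.
Let sD := semi_inner_linear_set hB.
Local Notation p := (seminorm B).
Local Notation E := (dual hB).
Implicit Types (f g : E) (u v k : X).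

Definition dual_app (f : E) (u : X) : F := val f u.

Lemma dual_antilinear f : antilinear D (dual_app f).
Proof. by have /asboolP[[]] := valP f. Qed.

Lemma dual_bounded f : exists2 C, 0 <= C &
  forall u, D u -> rnorm (dual_app f u) <= C * p u.
Proof.
have /asboolP[[_ [C hC]] _] := valP f.
exists `|C| => // u Du; apply: le_trans (hC u Du) _.
by rewrite ler_wpM2r ?seminorm_ge0 ?ler_norm.
Qed.

Lemma dual_ext f g : (forall u, D u -> dual_app f u = dual_app g u) -> f = g.
Proof.
move=> fg; apply/val_inj/funext => u.
have [Du|nDu] := pselect (D u); first exact: fg.
have /asboolP[_ ->//] := valP f.
by have /asboolP[_ ->] := valP g.
Qed.

Lemma dual_appP a f g u : dual_app (a *: f + g) u = a * dual_app f u + dual_app g u.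
Proof. by []. Qed.

Lemma dual_appB f g u : dual_app (f - g) u = dual_app f u - dual_app g u.
Proof. by []. Qed.

(** The default [0] of [insubd] is reached only when [l] is not bounded antilinear on [D]. *)
Definition to_dual (l : X -> F) : E :=
  insubd 0 (fun u => if `[< D u >] then l u else 0).

Lemma to_dualE l u : bounded_antilinear D B l -> D u -> dual_app (to_dual l) u = l u.
Proof.
move=> [al [C lC]] Du; rewrite /dual_app /to_dual insubdK; last first.
  apply/asboolP; split; last by move=> v nDv; rewrite asboolF.
  split=> [a v w Dv Dw|]; last by exists C => v Dv; rewrite asboolT// lC.
  by rewrite !asboolT ?al//; exact: linear_setP.
by rewrite asboolT.
Qed.

Lemma bounded_antilinear_form k : D k -> bounded_antilinear D B (B k).
Proof.
move=> Dk; split; first exact: (semi_innerPr hB).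
by exists (p k) => u Du; exact: (cauchy_schwarz hB).
Qed.

Definition dual_approx (f : E) k (e : R) : Prop :=
  [/\ D k, 0 <= e & forall u, D u -> rnorm (dual_app f u - B k u) <= e * p u].

Lemma dual_approx_form k : D k -> dual_approx (to_dual (B k)) k 0.
Proof.
move=> Dk; split=> // u Du; rewrite to_dualE//.
  by rewrite subrr rnorm0 mul0r.
exact: bounded_antilinear_form.
Qed.

Lemma ex_dual_approx f n : exists k, dual_approx f k (rate R n).
Proof.
have [C _ fC] := dual_bounded f.
have [k Dk hk] := approx_riesz hB (@dual_antilinear f) fC (rate_gt0 R n).
by exists k; split=> //; exact/ltW/rate_gt0.
Qed.

Lemma dual_approx_dist f k e k' e' : dual_approx f k e -> dual_approx f k' e' ->
  p (k - k') <= e + e'.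
Proof.
move=> [Dk e0 hk] [Dk' e'0 hk'].
apply: (seminorm_le_dual hB); rewrite ?addr_ge0//; first exact: linear_setB.
move=> u Du; rewrite (semi_innerBl hB)// mulrDl.
apply: le_trans (rdistD (dual_app f u) _ _) _.
by rewrite rdistC lerD ?hk ?hk'.
Qed.

Lemma dual_approx_le f k e C : dual_approx f k e -> 0 <= C ->
  (forall u, D u -> rnorm (dual_app f u) <= C * p u) -> p k <= C + e.
Proof.
move=> [Dk e0 hk] C0 fC; apply: (seminorm_le_dual hB); rewrite ?addr_ge0//.
move=> u Du; rewrite mulrDl -[B k u]subr0.
apply: le_trans (rdistD (dual_app f u) _ _) _.
by rewrite rdistC subr0 addrC lerD ?hk ?fC.
Qed.

(* The inner product of [f] and [g] is the limit of [f k] when [B k] tends to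
   [g] in the dual norm, at a rate linear in the error of approximation. *)
Definition is_dual_inner (f g : E) (z : F) : Prop :=
  exists C, forall k e, dual_approx g k e -> rnorm (dual_app f k - z) <= C * e.

(** Two approximants of [g] are close in seminorm and [f] is bounded, so the values of [f] along a
    sequence of approximants are Cauchy. The same estimate compares any other approximant with that
    sequence. *)
Lemma ex_is_dual_inner f g : exists z, is_dual_inner f g z.
Proof.
have [C C0 fC] := dual_bounded f.
have dist k e k' e' : dual_approx g k e -> dual_approx g k' e' ->
    rnorm (dual_app f k - dual_app f k') <= C * (e + e').
  move=> gk gk'; have [[Dk _ _] [Dk' _ _]] := (gk, gk').
  rewrite -(antilinearB (@dual_antilinear f))//.
  apply: le_trans (fC _ (linear_setB sD Dk Dk')) _.
  by rewrite ler_wpM2l// (dual_approx_dist gk gk').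
have /choice[h hP] := ex_dual_approx g.
have [//|n m|z hz] := @rate_complete_scalar R s (fun n => dual_app f (h n)) C.
  exact: dist.
exists z, C => k e gk; apply: (@le_rate _ (2 * C)) => n.
apply: le_trans (rdistD (dual_app f (h n)) _ _) _.
by have := dist _ _ _ _ gk (hP n); have := hz n; lra.
Qed.

Lemma is_dual_inner_uniq f g z z' :
  is_dual_inner f g z -> is_dual_inner f g z' -> z = z'.
Proof.
move=> [C hC] [C' hC']; apply/eqP; rewrite -subr_eq0; apply/eqP.
apply: rnorm_le0; apply: (@le_rate _ (C + C')) => n.
have [k gk] := ex_dual_approx g n.
apply: le_trans (rdistD (dual_app f k) _ _) _; rewrite rdistC.
by have := hC _ _ gk; have := hC' _ _ gk; lra.
Qed.

Definition dual_inner f g : F := xget 0 [set z | is_dual_inner f g z].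

Lemma dual_innerP f g : is_dual_inner f g (dual_inner f g).
Proof.
rewrite /dual_inner; case: xgetP => [z -> //|h].
by have [z /h] := ex_is_dual_inner f g.
Qed.

Lemma dual_inner_eq f g z : is_dual_inner f g z -> dual_inner f g = z.
Proof. exact/is_dual_inner_uniq/dual_innerP. Qed.

Lemma dual_innerPl a f g h :
  dual_inner (a *: f + g) h = a * dual_inner f h + dual_inner g h.
Proof.
apply: dual_inner_eq.
have [[C hC] [C' hC']] := (dual_innerP f h, dual_innerP g h).
exists (rnorm a * C + C') => k e hk; rewrite dual_appP opprD addrACA -mulrBr.
apply: le_trans (rnormD _ _) _; rewrite rnormM mulrDl -mulrA lerD ?hC'//.
by rewrite ler_wpM2l ?rnorm_ge0 ?hC.
Qed.

(** [B k] is approximated by [k] with error [0], which collapses the defining estimate to an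
    equality. This is the reproducing property of the dual. *)
Lemma dual_inner_form f k : D k -> dual_inner f (to_dual (B k)) = dual_app f k.
Proof.
move=> Dk; have [C /(_ _ _ (dual_approx_form Dk))] := dual_innerP f (to_dual (B k)).
by rewrite mulr0 => /rnorm_le0 /eqP; rewrite subr_eq0 => /eqP.
Qed.

(** The definition evaluates [f] and approximates [g], so both are approximated here: for [h] near
    [f] and [k] near [g], [g h] is close to [B k h = sconj (B h k)], which is close to
    [sconj (f k)]. The factor [C' + 1] bounds [p k], since rates are at most [1]. *)
Lemma dual_innerC f g : dual_inner f g = sconj (dual_inner g f).
Proof.
apply/esym; rewrite -[RHS]sconjK; congr sconj; apply: dual_inner_eq.
have [C hC] := dual_innerP f g.
have [C' C'0 gC] := dual_bounded g.
exists (C' + 1) => h e fh; have [Dh e0 hh] := fh.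
apply: (@le_rate _ (p h + C)) => n.
have [k gk] := ex_dual_approx g n; have [Dk _ hk] := gk.
have hk1 := hk h Dh; have hh1 := hh k Dk.
have := hC _ _ gk; have := dual_approx_le gk C'0 gC => pk hC1.
have pk1 : e * p k <= (C' + 1) * e.
  rewrite mulrC ler_wpM2r//; apply: le_trans pk _.
  by rewrite lerD2l rate_le1.
apply: le_trans (rdistD (B k h) _ _) _.
rewrite (semi_innerC hB Dk Dh); rewrite (semi_innerC hB Dk Dh) in hk1.
have : rnorm (sconj (B h k) - sconj (dual_inner f g)) <= e * p k + C * rate R n.
  rewrite -sconjN -sconjD rnorm_conj.
  apply: le_trans (rdistD (dual_app f k) _ _) _.
  by rewrite rdistC lerD.
by lra.
Qed.

(** Hermitian symmetry makes the value real. For [k] approximating [f], it is close to [f k], hence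
    to [B k k >= 0]. *)
Lemma dual_inner_ge0 f : 0 <= dual_inner f f.
Proof.
apply: ge0_sconjP; first by rewrite -dual_innerC.
have [C hC] := dual_innerP f f.
have [C' C'0 fC] := dual_bounded f.
rewrite -oppr_le0 -sReN; apply: (@le_rate _ (C + C' + 1)) => n.
have [k fk] := ex_dual_approx f n; have [Dk _ hk] := fk.
have := hC _ _ fk; have := hk k Dk.
have := dual_approx_le fk C'0 fC => pk h1 h2.
have pk1 : rate R n * p k <= rate R n * (C' + 1).
  apply: ler_wpM2l; first exact/ltW/rate_gt0.
  apply: le_trans pk _.
  by rewrite lerD2l rate_le1.
have := sRe_le_norm (dual_app f k - dual_inner f f).
have := sRe_le_norm (- (dual_app f k - B k k)).
rewrite rnormN !(sReN, sReD).
by have := sRe_ge0 (semi_inner_ge0 hB Dk); lra.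
Qed.

Lemma dual_inner_semi_inner : semi_inner [set: E] dual_inner.
Proof.
split=> //.
- by move=> a u v w _ _ _; exact: dual_innerPl.
- by move=> u v _ _; exact: dual_innerC.
- by move=> u _; exact: dual_inner_ge0.
Qed.

Local Notation pE := (seminorm dual_inner).

Lemma dual_app_le f u : D u -> rnorm (dual_app f u) <= pE f * p u.
Proof.
move=> Du; rewrite -dual_inner_form//.
apply: le_trans (cauchy_schwarz dual_inner_semi_inner _ _) _ => //.
suff -> : pE (to_dual (B u)) = p u by [].
by rewrite /seminorm dual_inner_form// to_dualE//; exact: bounded_antilinear_form.
Qed.

(** For [k] approximating [f], [<f, f>] is close to [f k], bounded by [C * p k <= C * (C + rate n)].
    Together with [dual_app_le], this identifies the norm of the inner product with the dual
    norm. *)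
Lemma dual_norm_le f C : 0 <= C ->
  (forall u, D u -> rnorm (dual_app f u) <= C * p u) -> pE f <= C.
Proof.
move=> C0 fC; rewrite -(@ler_pXn2r _ 2) ?nnegrE ?seminorm_ge0//.
rewrite (seminorm_sq dual_inner_semi_inner)//.
have [C' hC] := dual_innerP f f.
apply: (@le_rate _ (C + C')) => n.
have [k fk] := ex_dual_approx f n; have [Dk _ _] := fk.
have := hC _ _ fk; have := fC k Dk.
have := ler_wpM2l C0 (dual_approx_le fk C0 fC) => h1 h2 h3.
have := sRe_le_norm (dual_app f k).
have := sRe_le_norm (- (dual_app f k - dual_inner f f)).
by rewrite rnormN !(sReN, sReD); lra.
Qed.

Lemma dual_norm0_eq0 f : sreal s (pE f) = 0 -> f = 0.
Proof.
move=> f0; have {}f0 : pE f = 0 by rewrite -[LHS](sRe_real s) f0 sRe0.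
apply: dual_ext => u Du; apply/rnorm_le0.
by have := dual_app_le f Du; rewrite f0 mul0r.
Qed.

Lemma dual_normD f g : sreal s (pE (f + g)) <= sreal s (pE f) + sreal s (pE g).
Proof.
have -> (a b : R) : sreal s a + sreal s b = sreal s (a + b).
  by case: s => //=; rewrite rmorphD.
by rewrite ler_sreal; exact: (seminormD dual_inner_semi_inner).
Qed.

Lemma dual_normZ a f : sreal s (pE (a *: f)) = `|a| * sreal s (pE f).
Proof. by rewrite (seminormZ dual_inner_semi_inner)// srealM -rnormE. Qed.

HB.instance Definition _ :=
  @Lmodule_isNormed.Build F E (fun f => sreal s (pE f))
    dual_normD dual_normZ dual_norm0_eq0.

Lemma dual_rnorm f : rnorm f = pE f.
Proof. exact: sRe_real. Qed.

(** At each [u] in [D] the values are Cauchy with constant [C * p u]; this dependence on [u] is what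
    turns the pointwise rate into a rate in the dual norm. *)
Lemma dual_rate_complete : rate_complete E.
Proof.
move=> f C C0 hf.
have fun_le n m u : D u ->
    rnorm (dual_app (f n) u - dual_app (f m) u) <= C * p u * (rate R n + rate R m).
  move=> Du; rewrite -dual_appB mulrAC.
  apply: le_trans (dual_app_le _ Du) _.
  by rewrite ler_wpM2r ?seminorm_ge0// -dual_rnorm hf.
have /choice[l hl] u : exists z, D u -> forall n,
    rnorm (dual_app (f n) u - z) <= C * p u * rate R n.
  have [Du|] := pselect (D u); last by exists 0.
  have [|n m|z hz] := @rate_complete_scalar R s (fun n => dual_app (f n) u) (C * p u).
  - by rewrite mulr_ge0 ?seminorm_ge0.
  - exact: fun_le.
  - by exists z.
have bl : bounded_antilinear D B l.
  split=> [a u v Du Dv|].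
    have Dauv := linear_setP sD a Du Dv.
    apply/eqP; rewrite -subr_eq0; apply/eqP/rnorm_le0.
    apply: (@le_rate _ (C * p (a *: u + v) + rnorm a * (C * p u) + C * p v)) => n.
    apply: le_trans (rdistD (dual_app (f n) (a *: u + v)) _ _) _.
    rewrite (rdistC (l _)) dual_antilinear// opprD addrACA -mulrBr.
    have := hl _ Dauv n; rewrite dual_antilinear//.
    have := ler_wpM2l (rnorm_ge0 a) (hl _ Du n); have := hl _ Dv n.
    have := rnormD (sconj a * (dual_app (f n) u - l u)) (dual_app (f n) v - l v).
    by rewrite rnormM rnorm_conj; lra.
  have [C' C'0 f0C] := dual_bounded (f 0%N).
  (* [C] accounts for the distance from [l] to the term of index [0], where the rate is [1]. *)
  exists (C + C') => u Du; have := hl u Du 0%N; have := f0C u Du.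
  rewrite rate0 mulr1 mulrDl.
  by have := rdistD (dual_app (f 0%N) u) (l u) 0; rewrite !subr0 rdistC; lra.
exists (to_dual l) => n; rewrite dual_rnorm.
apply: dual_norm_le; first by rewrite mulr_ge0// ltW// rate_gt0.
move=> u Du; rewrite dual_appB to_dualE// mulrAC.
exact: hl.
Qed.

HB.instance Definition _ :=
  Uniform_isComplete.Build E (rate_complete_cauchy_cvg dual_rate_complete).

Lemma dual_inner_gt0 f : f != 0 -> 0 < dual_inner f f.
Proof.
move=> f0; rewrite lt_def dual_inner_ge0 andbT; apply: contra_neq f0 => f0.
by apply: dual_norm0_eq0; rewrite /seminorm f0 sRe0 sqrtr0 sreal0.
Qed.

Let dual_innerBl g : zmod_morphism (dual_inner^~ g).
Proof. by move=> u v; exact: (semi_innerBl dual_inner_semi_inner). Qed.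

Let dual_innerBr f : zmod_morphism (dual_inner f).
Proof. by move=> u v; exact: (semi_innerBr dual_inner_semi_inner). Qed.

Let dual_innerZr f : scalable_for (@sconj R s \; *%R) (dual_inner f).
Proof.
move=> a u; have sT := semi_inner_linear_set dual_inner_semi_inner.
exact: (antilinearZ sT (semi_innerPr dual_inner_semi_inner _)).
Qed.

Let dual_innerZl g : scalable_for *%R (dual_inner^~ g).
Proof.
move=> a u /=; rewrite dual_innerC [X in sconj X]dual_innerZr /= sconjM sconjK.
by rewrite -dual_innerC.
Qed.

HB.instance Definition _ :=
  isBilinear.Build F E E F *%R (@sconj R s \; *%R) dual_inner
    dual_innerBl dual_innerBr dual_innerZl dual_innerZr.

Let dual_inner_hermitian f g :
  dual_inner f g = (-1) ^+ false * sconj (dual_inner g f).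
Proof. by rewrite expr0 mul1r; exact: dual_innerC. Qed.

HB.instance Definition _ :=
  isHermitianSesquilinear.Build F E false (@sconj R s) dual_inner
    dual_inner_hermitian.

HB.instance Definition _ := isDotProduct.Build F E dual_inner dual_inner_gt0.

Lemma dual_inner_norm f : dual_inner f f = `|f| ^+ 2.
Proof.
by rewrite (semi_innerE dual_inner_semi_inner)// rnormE dual_rnorm !expr2 srealM.
Qed.

Definition dual_hilbert : hilbertType R s :=
  @HilbertType R s E dual_inner dual_inner_norm.

End DualInner.

(** * Positive operators *)

Section FormOperations.
Variables (R : realType) (s : scalar_kind).
Local Notation F := (scalar_field R s).
Variables (X : lmodType F) (D : set X).

Lemma semi_inner_pullback (H : hilbertType R s) (f : X -> H) : linear_set D ->
  (forall a u v, D u -> D v -> f (a *: u + v) = a *: f u + f v) ->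
  semi_inner D (fun u v => '[f u, f v]).
Proof.
move=> sD lf; split=> //.
- by move=> a u v w Du Dv _; rewrite lf// (semi_innerPl (inner_semi_inner H)).
- by move=> u v _ _; exact: inner_conj.
- by move=> u _; exact: (semi_inner_ge0 (inner_semi_inner H)).
Qed.

(** Sums produce the two graph forms used later: [<Tu, v> + <Tu, Tv>] on [dom T], and the product
    form on the graph of an adjoint. *)
Lemma semi_inner_add (B B' : X -> X -> F) :
  semi_inner D B -> semi_inner D B' ->
  semi_inner D (fun u v => B u v + B' u v).
Proof.
move=> hB hB'; split.
- exact: semi_inner_linear_set hB.
- move=> a u v w Du Dv Dw.
  by rewrite (semi_innerPl hB)// (semi_innerPl hB')// addrACA mulrDr.
- move=> u v Du Dv.
  by rewrite (semi_innerC hB)// (semi_innerC hB')// sconjD.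
- by move=> u Du; rewrite addr_ge0// ?(semi_inner_ge0 hB) ?(semi_inner_ge0 hB').
Qed.

Lemma seminorm_add_sq (B B' : X -> X -> F) u :
  semi_inner D B -> semi_inner D B' -> D u ->
  seminorm (fun u v => B u v + B' u v) u ^+ 2 = seminorm B u ^+ 2 + seminorm B' u ^+ 2.
Proof.
move=> hB hB' Du.
rewrite (seminorm_sq (semi_inner_add hB hB'))// (seminorm_sq hB)// (seminorm_sq hB')//.
exact: sReD.
Qed.

Lemma seminorm_addl (B B' : X -> X -> F) u :
  semi_inner D B -> semi_inner D B' -> D u ->
  seminorm B u <= seminorm (fun u v => B u v + B' u v) u.
Proof.
move=> hB hB' Du; rewrite -(@ler_pXn2r _ 2)// ?nnegrE ?seminorm_ge0//.
by rewrite (seminorm_add_sq hB hB')// lerDl sqr_ge0.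
Qed.

Lemma seminorm_addr (B B' : X -> X -> F) u :
  semi_inner D B -> semi_inner D B' -> D u ->
  seminorm B' u <= seminorm (fun u v => B u v + B' u v) u.
Proof.
move=> hB hB' Du; rewrite -(@ler_pXn2r _ 2)// ?nnegrE ?seminorm_ge0//.
by rewrite (seminorm_add_sq hB hB')// lerDr sqr_ge0.
Qed.

End FormOperations.

(** * The form of a positive operator and the subspace [Dstar] *)

Section PositiveOperator.
Variables (R : realType) (s : scalar_kind) (H : hilbertType R s).
Local Notation F := (scalar_field R s).

Lemma operator_linear_set (K : hilbertType R s) (T : operator H K) :
  linear_set (dom T).
Proof. by split; [exact: domT0|exact: dom_linear]. Qed.

Lemma inner0l (K : hilbertType R s) (x : K) : '[0, x] = 0.
Proof. by rewrite -(subrr 0) innerBl subrr. Qed.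

Lemma op0 (K : hilbertType R s) (T : operator H K) : T 0 = 0.
Proof.
have := opfun_linear 1 (domT0 T) (domT0 T); rewrite !scale1r addr0 => /eqP.
by rewrite -subr_eq subrr eq_sym => /eqP.
Qed.

Definition op_form (T : operator H H) : H -> H -> F := fun u v => '[T u, v].

Variables (T : operator H H) (T_pos : positive_op T).
Local Notation q := (op_form T).

Lemma op_form_semi_inner : semi_inner (dom T) q.
Proof.
split; first exact: operator_linear_set.
- move=> a u v w Du Dv _; rewrite /op_form opfun_linear//.
  by rewrite (semi_innerPl (inner_semi_inner H)).
- by move=> u v Du Dv; rewrite /op_form (T_pos.1)// inner_conj.
- by move=> u Du; exact: T_pos.2.
Qed.

Lemma op_form_le1 h : dom T h -> ('[T h, h] <= 1) = (seminorm q h <= 1).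
Proof.
move=> Dh; have := semi_innerE op_form_semi_inner Dh; rewrite {1}/op_form => ->.
by rewrite -(sreal1 R s) ler_sreal expr_le1// seminorm_ge0.
Qed.

(** The supremum in [Dstar] runs over the unit ball of the seminorm of [T], so by homogeneity its
    finiteness is a bound by a multiple of that seminorm. *)
Lemma DstarP g : Dstar T g <->
  exists C, forall h, dom T h -> rnorm '[T h, g] <= C * seminorm q h.
Proof.
have hq := op_form_semi_inner.
split=> [supg|[C hC]]; last first.
  rewrite /Dstar /=; apply: (@le_lt_trans _ _ ((C ^+ 2)%:E)); last exact: ltry.
  apply: ub_ereal_sup => _ [h [Dh h1] <-]; rewrite lee_fin.
  rewrite -mul_sconj -rnorm_sq -[C ^+ 2]mulr1.
  have p1 : seminorm q h ^+ 2 <= 1.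
    by rewrite expr_le1 ?seminorm_ge0// -op_form_le1.
  have := rnorm_ge0 '[T h, g]; have := hC h Dh; have := seminorm_ge0 q h.
  move=> p0 hC1 n0; apply: (@le_trans _ _ ((C * seminorm q h) ^+ 2)).
    by rewrite ler_pXn2r ?nnegrE// (le_trans n0).
  by rewrite exprMn ler_wpM2l ?sqr_ge0.
have [M hM] : exists M : R, forall h, dom T h -> '[T h, h] <= 1 ->
    rnorm '[T h, g] ^+ 2 <= M.
  move: supg; rewrite /Dstar /=; set A := (X in ereal_sup X) => supg.
  exists (fine (ereal_sup A)) => h Dh h1.
  have Ah : A (rnorm '[T h, g] ^+ 2)%:E.
    by exists h => //; rewrite -mul_sconj -rnorm_sq.
  have supA := ereal_sup_ubound Ah.
  rewrite -lee_fin fineK// fin_numE -ltey supg andbT gt_eqF//.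
  by apply: lt_le_trans supA; exact: ltNyr.
have M0 : 0 <= M.
  have D0 := domT0 T; apply: le_trans (hM 0 D0 _); first exact: sqr_ge0.
  by rewrite op_form_le1// /seminorm /op_form op0 inner0l sRe0 sqrtr0.
(* Null vectors cannot be normalized; dividing by [seminorm q h + rate n] puts every [h] in the unit
   ball, at a cost that vanishes with [n]. *)
exists (Num.sqrt M) => h Dh; apply: (@le_rate _ (Num.sqrt M)) => n.
rewrite -mulrDr; set t := seminorm q h + rate R n.
have t0 : 0 < t by rewrite ltr_wpDl ?seminorm_ge0 ?rate_gt0.
have tV0 : 0 <= t^-1 by rewrite invr_ge0 ltW.
pose u := sreal s t^-1 *: h.
have Du : dom T u by exact: (linear_setZ (operator_linear_set T)).
have pu : '[T u, u] <= 1.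
  rewrite op_form_le1// (seminormZ hq)// rnorm_real ger0_norm//.
  by rewrite ler_pdivrMl// mulr1 lerDl ltW// rate_gt0.
have : rnorm '[T u, g] <= Num.sqrt M.
  by rewrite -[leLHS]ger0_norm ?rnorm_ge0// -sqrtr_sqr ler_sqrt// hM.
have -> : '[T u, g] = sreal s t^-1 * '[T h, g].
  rewrite /u -[_ *: h]addr0 (opfun_linear _ Dh (domT0 T)).
  rewrite (semi_innerPl (inner_semi_inner H))//.
  by rewrite op0 inner0l addr0.
by rewrite rnormM rnorm_real ger0_norm// ler_pdivrMl// mulrC.
Qed.

Lemma Dstar_linear_set : linear_set (Dstar T).
Proof.
split.
  apply/DstarP; exists 0 => h Dh; rewrite mul0r.
  by rewrite -(subrr 0) innerBr subrr rnorm0.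
move=> a u v /DstarP[C hC] /DstarP[C' hC']; apply/DstarP.
exists (rnorm a * C + C') => h Dh.
rewrite (semi_innerPr (inner_semi_inner H))//.
apply: le_trans (rnormD _ _) _; rewrite rnormM rnorm_conj mulrDl -mulrA.
by rewrite lerD ?hC'// ler_wpM2l ?rnorm_ge0 ?hC.
Qed.

Lemma dom_Dstar : dom T `<=` Dstar T.
Proof.
move=> g Dg; apply/DstarP; exists (seminorm q g) => h Dh; rewrite mulrC.
exact: (cauchy_schwarz op_form_semi_inner).
Qed.

End PositiveOperator.

(** * From a positive extension to closability *)

Section Implications.
Variables (R : realType) (s : scalar_kind) (H : hilbertType R s).
Local Notation F := (scalar_field R s).
Variables (T : operator H H) (T_pos : positive_op T).
Local Notation q := (op_form T).

(** The Cauchy-Schwarz inequality for the form of [S] bounds [<Th, g> = <Sh, g>] for [g] in [dom S],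
    so [dom S] lies in [Dstar T]. *)
Lemma dense_Dstar_of_extension (S : operator H H) :
  extends S T -> positive_op S -> dense (dom S) -> dense (Dstar T).
Proof.
move=> [TS ST] S_pos dS.
have SD : dom S `<=` Dstar T.
  move=> g Sg; apply/DstarP => //; exists (seminorm (op_form S) g) => h Dh.
  rewrite -ST// mulrC.
  have -> : seminorm q h = seminorm (op_form S) h.
    by rewrite /seminorm /op_form ST.
  by apply: (cauchy_schwarz (op_form_semi_inner S_pos)) => //; exact: TS.
move=> O O0 oO; have [x [Ox Sx]] := dS O O0 oO.
by exists x; split=> //; exact: SD.
Qed.

(** Pairing [x = h + T h] with [h], which lies in [Dstar T], gives [<h, h> + <Th, h> = 0]. Both
    terms are nonnegative, hence [h = 0]. *)
Lemma orthocompl_Dstar_closure_ran :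
  orthocompl (Dstar T) `<=` [set h + T h | h in dom T] ->
  orthocompl (Dstar T) `&` closure (ran T) = [set 0].
Proof.
move=> sub; apply/seteqP; split=> [x [xD _]|_ ->]; last first.
  split; first by move=> a _; exact: inner0l.
  by apply: subset_closure; exists 0; [exact: domT0|exact: op0].
have [h Dh hx] := sub x xD.
have := xD h (dom_Dstar T_pos Dh); rewrite -hx innerDl => hh0.
have h0 : h = 0.
  apply: inner_eq0; apply/eqP; rewrite eq_le.
  rewrite (semi_inner_ge0 (inner_semi_inner H))// andbT -hh0 lerDl.
  exact: T_pos.2.
by rewrite h0 op0 addr0.
Qed.

(** For [g] in [Dstar T], [<T (h n), g>] is bounded by a multiple of the seminorm of [h n], which
    tends to [0]; so the limit [f] is orthogonal to [Dstar T]. *)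
Lemma closable_of_orthocompl :
  orthocompl (Dstar T) `&` closure (ran T) = [set 0] ->
  forall (h : nat -> H) (f : H), (forall n, dom T (h n)) ->
      '[T (h n), h n] @[n --> \oo] --> (0 : F) ->
      T (h n) @[n --> \oo] --> f -> f = 0.
Proof.
move=> D0 h f Dh q0 Tf.
suff : (orthocompl (Dstar T) `&` closure (ran T)) f by rewrite D0.
split; last first.
  move=> A /Tf [N _ /(_ N (leqnn N)) AN].
  by exists (T (h N)); split=> //; exists (h N).
move=> g /(DstarP T_pos) [C hC]; apply: rnorm_le0.
apply: (@le_rate _ (`|C| + rnorm g)) => n; rewrite add0r.
(* The rate is squared because the seminorm is the square root of the form. *)
have [N _ hN] : \forall m \near \oo,
    `|0 - '[T (h m), h m]| < sreal s (rate R n ^+ 2).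
  by apply: (cvgrPdist_lt _ _).1; [exact: q0|rewrite sreal_gt0 exprn_gt0// rate_gt0].
have [m Nm hm] := cvg_rnorm_lt Tf N (rate_gt0 R n).
have hq := op_form_semi_inner T_pos.
have pm : seminorm q (h m) <= rate R n.
  have := hN m Nm; rewrite sub0r rnormE ltr_sreal rnormN.
  rewrite -[X in rnorm X]/(q (h m) (h m)) (semi_innerE hq)// rnorm_real.
  rewrite ger0_norm ?sqr_ge0// => /ltW.
  by rewrite ler_pXn2r ?nnegrE ?seminorm_ge0// ltW// rate_gt0.
have -> : '[f, g] = '[T (h m), g] - '[T (h m) - f, g].
  by rewrite innerBl opprB addrC subrK.
apply: le_trans (rnormD _ _) _; rewrite rnormN mulrDl; apply: lerD.
  apply: le_trans (hC _ (Dh m)) _.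
  apply: le_trans (ler_wpM2r (seminorm_ge0 _ _) (ler_norm C)) _.
  exact: ler_wpM2l.
apply: le_trans (inner_cauchy_schwarz _ _) _; rewrite mulrC.
by apply: ler_wpM2l; [exact: rnorm_ge0|exact: ltW].
Qed.

End Implications.

(** * Factorization of closable operators *)

Section ClosableToFactorization.
Variables (R : realType) (s : scalar_kind) (H : hilbertType R s).
Local Notation F := (scalar_field R s).
Variables (T : operator H H) (T_pos : positive_op T).
Local Notation q := (op_form T).

(** This is closability of [T] as a map from [dom T], with the seminorm of its form, into [H]. *)
Definition op_closable : Prop :=
  forall (h : nat -> H) (f : H), (forall n, dom T (h n)) ->
    '[T (h n), h n] @[n --> \oo] --> (0 : F) ->
    T (h n) @[n --> \oo] --> f -> f = 0.

(* Projecting [(0, f)] onto the closure of [{(h, T h)}], where [h] carries the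
   seminorm of [T], the component of the error along [H] lies in [Dstar T]. *)
Lemma Dstar_dense : op_closable -> dense (Dstar T).
Proof.
move=> Tcl; apply: orthocompl_dense; first exact: Dstar_linear_set.
move=> f fD.
have hq := op_form_semi_inner T_pos.
have sD := operator_linear_set T.
have hT : semi_inner (dom T) (fun u v => '[T u, T v]).
  by apply: semi_inner_pullback => // a u v; exact: opfun_linear.
have hB := semi_inner_add hq hT.
set B := (fun u v => q u v + _) in hB.
have qB u : dom T u -> seminorm q u <= seminorm B u := seminorm_addl hq hT.
have TB u : dom T u -> rnorm (T u) <= seminorm B u.
  by move=> Du; rewrite -inner_seminorm; exact: (seminorm_addr hq hT).
have [h [Dh fh hh]] : exists h : nat -> H, [/\ forall n, dom T (h n),
    forall n u, dom T u -> rnorm ('[f, T u] - B (h n) u) <= rate R n * seminorm B u &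
    forall n m, seminorm B (h n - h m) <= rate R n + rate R m].
  apply: (riesz_sequence hB (C := rnorm f)).
    move=> a u v Du Dv; rewrite opfun_linear//.
    exact: (semi_innerPr (inner_semi_inner H)).
  move=> u Du; apply: le_trans (inner_cauchy_schwarz _ _) _.
  by apply: ler_wpM2l; [exact: rnorm_ge0|exact: TB].
have opB u v : dom T u -> dom T v -> T (u - v) = T u - T v.
  by move=> Du Dv; rewrite addrC -scaleN1r opfun_linear// scaleN1r addrC.
have [//|n m|l hl] := @rate_complete_completeNormedMod R s H (T \o h) 1.
  rewrite /= -opB// mul1r; apply: le_trans (hh n m).
  by apply: TB; exact: linear_setB.
have {}hl n : rnorm (T (h n) - l) <= rate R n by have := hl n; rewrite mul1r.
pose g := f - l.
(* [B (h n) k] splits into [q (h n) k] and [<T (h n), T k>]. The latter tends to [<l, T k>], so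
   [<g, T k>] is the limit of [q (h n) k]. *)
have gq n k : dom T k ->
    rnorm ('[g, T k] - q (h n) k) <= rate R n * (seminorm B k + rnorm (T k)).
  move=> Dk.
  have -> : '[g, T k] - q (h n) k = ('[f, T k] - B (h n) k) + '[T (h n) - l, T k].
    by rewrite /B /g !innerBl; ring.
  apply: le_trans (rnormD _ _) _; rewrite mulrDr lerD ?fh//.
  apply: le_trans (inner_cauchy_schwarz _ _) _.
  by apply: ler_wpM2r; [exact: rnorm_ge0|exact: hl].
(* Every [h n] lies within [rate n + rate 0 <= 2] of [h 0]. *)
pose M := seminorm B (h 0%N) + 2.
have hM n : seminorm B (h n) <= M.
  have Dn0 := linear_setB sD (Dh n) (Dh 0%N).
  have := seminormD hB Dn0 (Dh 0%N); rewrite subrK => /le_trans; apply.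
  rewrite addrC lerD2l; apply: le_trans (hh n 0%N) _.
  by rewrite rate0; have := rate_le1 R n; lra.
have Dg : Dstar T g.
  apply/DstarP => //; exists M => k Dk.
  apply: (@le_rate _ (seminorm B k + rnorm (T k))) => n.
  rewrite inner_conj rnorm_conj.
  have := rdistD (q (h n) k) '[g, T k] 0; rewrite !subr0 => /le_trans; apply.
  rewrite addrC; apply: lerD; last by rewrite mulrC; exact: gq.
  apply: le_trans (cauchy_schwarz hq (Dh n) Dk) _.
  apply: ler_wpM2r; first exact: seminorm_ge0.
  by apply: le_trans (qB _ (Dh n)) (hM n).
(* As [g] is in [Dstar T], [f] is orthogonal to it, so [<g, l> = - <g, g>]. Taking [k = h n] in the
   limit relation then yields a sum of two squares tending to [0]: one gives [l = f], the other that
   the form vanishes along [h], as closability requires. *)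
have gg_le n : rnorm g ^+ 2 + seminorm q (h n) ^+ 2 <= (2 * M + rnorm g) * rate R n.
  have e1 : '[g, T (h n)] - q (h n) (h n) =
      '[g, T (h n) - l] - ('[g, g] + q (h n) (h n)).
    have gf : '[g, f] = 0 by rewrite inner_conj fD ?sconj0.
    have -> : '[g, g] = - '[g, l] by rewrite {2}/g innerBr gf sub0r.
    by rewrite innerBr; ring.
  have := gq n _ (Dh n); rewrite e1.
  have := sRe_le_norm (- ('[g, T (h n) - l] - ('[g, g] + q (h n) (h n)))).
  have := sRe_le_norm '[g, T (h n) - l].
  rewrite rnormN !(sReN, sReD) inner_rnorm (semi_innerE hq)// !sRe_real.
  have := inner_cauchy_schwarz g (T (h n) - l).
  have := ler_wpM2l (rnorm_ge0 g) (hl n).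
  have : rate R n * (seminorm B (h n) + rnorm (T (h n))) <= rate R n * (2 * M).
    apply: ler_wpM2l; first exact/ltW/rate_gt0.
    by have := hM n; have := TB _ (Dh n); lra.
  by lra.
have g0 : g = 0.
  apply: rnorm_le0; rewrite -(@ler_pXn2r _ 2) ?nnegrE ?rnorm_ge0// expr0n /=.
  apply: (@le_rate _ (2 * M + rnorm g)) => n.
  by have := gg_le n; have := sqr_ge0 (seminorm q (h n)); lra.
apply: (Tcl h f Dh).
  apply: (@cvg_rate _ _ _ _ _ (2 * M + rnorm g)) => n.
  rewrite subr0 -[X in rnorm X]/(q (h n) (h n)) (semi_innerE hq)// rnorm_real.
  rewrite ger0_norm ?sqr_ge0//.
  by have := gg_le n; have := sqr_ge0 (rnorm g); lra.
apply: (@cvg_rate _ _ _ _ _ 1) => n; rewrite mul1r.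
by have /eqP := g0; rewrite subr_eq0 => /eqP ->.
Qed.

Let hq : semi_inner (dom T) q := op_form_semi_inner T_pos.
Local Notation E := (dual_hilbert hq).

Definition factor (g : H) : E :=
  if `[< Dstar T g >] then to_dual hq (fun k => '[g, T k]) else 0.

Lemma factorE g k : Dstar T g -> dom T k -> dual_app (factor g) k = '[g, T k].
Proof.
move=> Dg Dk; rewrite /factor asboolT// to_dualE//; split.
  move=> a u v Du Dv; rewrite opfun_linear//.
  exact: (semi_innerPr (inner_semi_inner H)).
have [C hC] := (DstarP T_pos g).1 Dg.
by exists C => u Du; rewrite inner_conj rnorm_conj; exact: hC.
Qed.

Lemma factor_linear a u v : Dstar T u -> Dstar T v ->
  factor (a *: u + v) = a *: factor u + factor v.
Proof.
move=> Du Dv; apply: dual_ext => k Dk.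
have Dauv := linear_setP (Dstar_linear_set T_pos) a Du Dv.
by rewrite dual_appP !factorE// (semi_innerPl (inner_semi_inner H)).
Qed.

Definition factor_op : operator H E :=
  Operator (linear_set0 (Dstar_linear_set T_pos))
    (linear_setP (Dstar_linear_set T_pos)) factor_linear.

(** Symmetry of [T] rewrites [<h, T k>] as [<T h, k>]. On [dom T] the factor thus takes the
    representable functionals as values, so the reproducing property gives both the factorization
    identity and the trivial orthocomplement. *)
Lemma factor_dom h : dom T h -> factor h = to_dual hq (q h).
Proof.
move=> Dh; apply: dual_ext => k Dk.
rewrite factorE//; last exact: dom_Dstar.
rewrite to_dualE//; last exact: (bounded_antilinear_form hq).
by rewrite /op_form (T_pos.1).
Qed.

Lemma factorization_of_closable : op_closable ->
  exists (E : hilbertType R s) (V : operator H E),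
      [/\ dense (dom V),
          dom T `<=` dom V,
          orthocompl (V @` dom T) = [set 0] &
          forall g h : H, dom V g -> dom T h ->
            '[V g, V h] = '[g, T h] ].
Proof.
move=> Tcl; exists E, factor_op; split.
- exact: Dstar_dense.
- exact: dom_Dstar.
- apply/seteqP; split=> [f fV|_ -> a _]; last exact: inner0l.
  apply: (@dual_ext _ _ _ _ _ hq) => h Dh.
  rewrite -dual_inner_form// -factor_dom//.
  by apply: fV; exists h.
- move=> g h Dg Dh.
  rewrite -(factorE Dg Dh) -dual_inner_form// -factor_dom//.
Qed.

End ClosableToFactorization.

(** * The Krein-von Neumann extension *)

Section SelfAdjoint.
Variables (R : realType) (s : scalar_kind) (H : hilbertType R s).

(** If [x = y + S y] is orthogonal to [dom S], pairing with [y] forces [y = 0], whence density. If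
    [k] is the adjoint value at [g], solving [y + S y = g + k] makes [g - y] orthogonal to the range
    of [I + S], which is everything. *)
Lemma self_adjoint_of_onto (S : operator H H) : positive_op S ->
  (forall x, exists2 y, dom S y & y + S y = x) -> self_adjoint S.
Proof.
move=> [Ssym Sge0] onto; split.
  apply: orthocompl_dense; first exact: operator_linear_set.
  move=> x xS; have [y Dy yx] := onto x.
  have := xS y Dy; rewrite -yx innerDl => yy0.
  have -> : y = 0.
    apply: inner_eq0; apply/eqP; rewrite eq_le.
    rewrite (semi_inner_ge0 (inner_semi_inner H))// andbT -yy0 lerDl.
    exact: Sge0.
  by rewrite op0 addr0.
split; last exact: Ssym.
apply/seteqP; split=> [g Dg|g [k gk]].
  by exists (S g) => f Df; exact: Ssym.
have [y Dy ygk] := onto (g + k).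
suff -> : g = y by [].
have gy f : dom S f -> '[f + S f, g - y] = 0.
  move=> Df; rewrite innerBr 2!innerDl gk// (Ssym f y)//.
  by rewrite -!innerDr -ygk subrr.
apply/eqP; rewrite -subr_eq0; apply/eqP; apply: inner_eq0.
by have [f Df fgy] := onto (g - y); have := gy f Df; rewrite fgy.
Qed.

End SelfAdjoint.

(** * Extension obtained from a factorization *)

Section FactorizationToExtension.
Variables (R : realType) (s : scalar_kind) (H E : hilbertType R s).
Local Notation F := (scalar_field R s).
Variables (T : operator H H) (V : operator H E).
Hypotheses (dV : dense (dom V)) (TV : dom T `<=` dom V).
Hypothesis VT0 : orthocompl (V @` dom T) = [set 0].
Hypothesis VT : forall g h, dom V g -> dom T h -> '[V g, V h] = '[g, T h].

(** The graph of [V^*], kept as a subspace of [E * H] so that pairs such as [(0, x)] can be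
    approximated from it. *)
Definition adjoint_graph (w : E * H) : Prop :=
  forall g, dom V g -> '[V g, w.1] = '[g, w.2].

Lemma adjoint_graph_dom h : dom T h -> adjoint_graph (V h, T h).
Proof. by move=> Dh g Dg; exact: VT. Qed.

Lemma adjoint_graph_linear : linear_set (adjoint_graph : set (E * H)).
Proof.
split=> [g _|a u v uA vA g Dg] /=.
  by rewrite inner_conj inner0l [RHS]inner_conj inner0l.
rewrite (semi_innerPr (inner_semi_inner E))// uA// vA//.
by rewrite (semi_innerPr (inner_semi_inner H)).
Qed.

(* The graph of [V^* V^**], the Krein-von Neumann extension; [e] is the value
   of [V^**] at [y]. *)
Definition krein_graph (y z : H) : Prop := exists e : E,
  adjoint_graph (e, z) /\
  forall w, adjoint_graph w -> '[w.2, y] = '[w.1, e].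

Lemma krein_graph_dom h : dom T h -> krein_graph h (T h).
Proof.
move=> Dh; exists (V h); split; first exact: adjoint_graph_dom.
move=> w wA; rewrite inner_conj -(wA _ (TV Dh)).
exact/esym/inner_conj.
Qed.

(** Testing on the pairs [(V h, T h)] determines [e] modulo the orthocomplement of [V (dom T)],
    which is trivial; density of [dom V] then determines [z] from [e]. *)
Lemma krein_graph_uniq y z z' : krein_graph y z -> krein_graph y z' -> z = z'.
Proof.
move=> [e [ez ey]] [e' [ez' ey']].
have ee : e = e'.
  apply/eqP; rewrite -subr_eq0; apply/eqP.
  suff : orthocompl (V @` dom T) (e - e') by rewrite VT0.
  move=> _ [h Dh <-]; rewrite inner_conj innerBr.
  have hA := adjoint_graph_dom Dh.
  by rewrite -(ey _ hA) -(ey' _ hA) subrr sconj0.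
apply/eqP; rewrite -subr_eq0; apply/eqP.
apply: (dense_orthocompl dV) => g Dg.
rewrite inner_conj innerBr -(ez _ Dg) -(ez' _ Dg) ee subrr sconj0 //.
Qed.

Lemma krein_graph_linear a y z y' z' : krein_graph y z -> krein_graph y' z' ->
  krein_graph (a *: y + y') (a *: z + z').
Proof.
move=> [e [ez ey]] [e' [ez' ey']]; exists (a *: e + e'); split.
  exact: (linear_setP adjoint_graph_linear a ez ez').
move=> w wA; rewrite (semi_innerPr (inner_semi_inner H))// ey// ey'//.
by rewrite (semi_innerPr (inner_semi_inner E)).
Qed.

(** Both sides equal [<e, e'>], the inner product of the intermediate values in [E]. *)
Lemma krein_graph_inner y z y' z' : krein_graph y z -> krein_graph y' z' ->
  '[z, y'] = '[y, z'].
Proof.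
move=> [e [ez ey]] [e' [ez' ey']].
by rewrite (ey' _ ez) [RHS]inner_conj (ey _ ez') -inner_conj.
Qed.

Lemma krein_graph_ge0 y z : krein_graph y z -> 0 <= '[z, y].
Proof.
by move=> [e [ez ey]]; rewrite (ey _ ez) (semi_inner_ge0 (inner_semi_inner E)).
Qed.

(** If [(e, z)] is the projection of [(0, x)], orthogonality of the error to the graph reads
    [<x - z, u.2> = <e, u.1>], that is [V^** (x - z) = e], while [V^* e = z]. This dictates
    [y = x - z]. *)
Lemma krein_graph_onto x : exists y z, krein_graph y z /\ y + z = x.
Proof.
have sA := adjoint_graph_linear.
have h1 : semi_inner (adjoint_graph : set (E * H)) (fun u v => '[u.1, v.1]).
  exact: semi_inner_pullback.
have h2 : semi_inner (adjoint_graph : set (E * H)) (fun u v => '[u.2, v.2]).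
  exact: semi_inner_pullback.
have hB := semi_inner_add h1 h2.
set B := (fun u v : E * H => _ + _) in hB.
have B1 u : adjoint_graph u -> rnorm u.1 <= seminorm B u.
  by move=> uA; rewrite -inner_seminorm; exact: (seminorm_addl h1 h2).
have B2 u : adjoint_graph u -> rnorm u.2 <= seminorm B u.
  by move=> uA; rewrite -inner_seminorm; exact: (seminorm_addr h1 h2).
have [w [wA xw ww]] : exists w : nat -> E * H, [/\ forall n, adjoint_graph (w n),
    forall n u, adjoint_graph u ->
      rnorm ('[x, u.2] - B (w n) u) <= rate R n * seminorm B u &
    forall n m, seminorm B (w n - w m) <= rate R n + rate R m].
  apply: (riesz_sequence hB (C := rnorm x)).
    by move=> a u v _ _; exact: (semi_innerPr (inner_semi_inner H)).
  move=> u uA; apply: le_trans (inner_cauchy_schwarz _ _) _.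
  by apply: ler_wpM2l; [exact: rnorm_ge0|exact: B2].
have [//|n m|e he] := @rate_complete_completeNormedMod R s E (fun n => (w n).1) 1.
  rewrite mul1r; apply: le_trans (ww n m).
  exact: (B1 _ (linear_setB sA (wA n) (wA m))).
have [//|n m|z hz] := @rate_complete_completeNormedMod R s H (fun n => (w n).2) 1.
  rewrite mul1r; apply: le_trans (ww n m).
  exact: (B2 _ (linear_setB sA (wA n) (wA m))).
have {}he n : rnorm ((w n).1 - e) <= rate R n by have := he n; rewrite mul1r.
have {}hz n : rnorm ((w n).2 - z) <= rate R n by have := hz n; rewrite mul1r.
exists (x - z), z; split; last by rewrite subrK.
exists e; split.
  move=> g Dg /=; apply/eqP; rewrite -subr_eq0; apply/eqP/rnorm_le0.
  apply: (@le_rate _ (rnorm (V g) + rnorm g)) => n; rewrite add0r.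
  have -> : '[V g, e] - '[g, z] = '[g, (w n).2 - z] - '[V g, (w n).1 - e].
    by rewrite !innerBr (wA n g Dg); ring.
  apply: le_trans (rnormD _ _) _; rewrite rnormN mulrDl addrC.
  apply: lerD; apply: le_trans (inner_cauchy_schwarz _ _) _.
    by apply: ler_wpM2l; [exact: rnorm_ge0|exact: he].
  by apply: ler_wpM2l; [exact: rnorm_ge0|exact: hz].
move=> u uA; rewrite inner_conj [RHS]inner_conj; congr sconj.
apply/eqP; rewrite -subr_eq0; apply/eqP/rnorm_le0.
apply: (@le_rate _ (seminorm B u + rnorm u.1 + rnorm u.2)) => n; rewrite add0r.
have -> : '[x - z, u.2] - '[e, u.1] =
    ('[x, u.2] - B (w n) u) + '[(w n).1 - e, u.1] + '[(w n).2 - z, u.2].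
  by rewrite /B !innerBl; ring.
rewrite !mulrDl; apply: le_trans (rnormD _ _) _; apply: lerD; last first.
  apply: le_trans (inner_cauchy_schwarz _ _) _; rewrite mulrC.
  by apply: ler_wpM2l; [exact: rnorm_ge0|exact: hz].
apply: le_trans (rnormD _ _) _; apply: lerD; last first.
  apply: le_trans (inner_cauchy_schwarz _ _) _; rewrite mulrC.
  by apply: ler_wpM2l; [exact: rnorm_ge0|exact: he].
by rewrite mulrC; exact: xw.
Qed.

Definition krein_fun (y : H) : H := xget 0 [set z | krein_graph y z].

Lemma krein_funP y : (exists z, krein_graph y z) -> krein_graph y (krein_fun y).
Proof.
rewrite /krein_fun => -[z yz]; case: xgetP => [_ -> //|h].
by have := h z yz.
Qed.

Lemma krein_fun_eq y z : krein_graph y z -> krein_fun y = z.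
Proof.
move=> yz; have Gy := krein_funP (ex_intro _ z yz).
exact: krein_graph_uniq Gy yz.
Qed.

Let krein_dom : set H := [set y | exists z, krein_graph y z].

Let krein_dom0 : krein_dom 0.
Proof. by exists (T 0); exact/krein_graph_dom/domT0. Qed.

Let krein_dom_linear a u v : krein_dom u -> krein_dom v -> krein_dom (a *: u + v).
Proof.
by move=> [z uz] [z' vz']; exists (a *: z + z'); exact: krein_graph_linear.
Qed.

Let krein_fun_linear a u v : krein_dom u -> krein_dom v ->
  krein_fun (a *: u + v) = a *: krein_fun u + krein_fun v.
Proof.
by move=> /krein_funP Gu /krein_funP Gv; exact/krein_fun_eq/krein_graph_linear.
Qed.

Definition krein_op : operator H H :=
  Operator krein_dom0 krein_dom_linear krein_fun_linear.

Lemma extension_of_factorization :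
  exists S : operator H H, [/\ extends S T, positive_op S & self_adjoint S].
Proof.
have S_pos : positive_op krein_op.
  split=> [f g /krein_funP Gf /krein_funP Gg|f /krein_funP Gf].
    exact: krein_graph_inner.
  exact: krein_graph_ge0.
exists krein_op; split=> //.
  split=> f Df; first by exists (T f); exact: krein_graph_dom.
  exact/krein_fun_eq/krein_graph_dom.
apply: self_adjoint_of_onto => // x.
have [y [z [yz yzx]]] := krein_graph_onto x.
exists y; first by exists z.
by have -> : krein_op y = z by exact: krein_fun_eq.
Qed.

End FactorizationToExtension.

Theorem theorem2p1 (R : realType) (s : scalar_kind) (H : hilbertType R s)
    (T : operator H H) (T_pos : positive_op T) :
  [<->
    (* (i) *)
    exists S : operator H H, [/\ extends S T, positive_op S & self_adjoint S];
    (* (ii) *)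
    dense (Dstar T);
    (* (iii) *)
    orthocompl (Dstar T) `<=` [set h + T h | h in dom T];
    (* (iv) *)
    orthocompl (Dstar T) `&` closure (ran T) = [set 0];
    (* (v) *)
    forall (h : nat -> H) (f : H), (forall n, dom T (h n)) ->
      '[T (h n), h n] @[n --> \oo] --> (0 : scalar_field R s) ->
      T (h n) @[n --> \oo] --> f ->
      f = 0;
    (* (vi) *)
    exists (E : hilbertType R s) (V : operator H E),
      [/\ dense (dom V),
          dom T `<=` dom V,
          orthocompl (V @` dom T) = [set 0] &
          forall g h : H, dom V g -> dom T h ->
            '[V g, V h] = '[g, T h] ] ].
Proof.
tfae.
- by move=> [S [TS S_pos [dS _]]]; exact: dense_Dstar_of_extension TS S_pos dS.
(* Density leaves only [x = 0], which is [0 + T 0]. *)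
- move=> dD x xD; exists 0; first exact: domT0.
  by rewrite op0 addr0 (dense_orthocompl dD xD).
- exact: orthocompl_Dstar_closure_ran.
- exact: closable_of_orthocompl.
- exact: factorization_of_closable.
- by move=> [E [V [dV TV VT0 VT]]]; exact: extension_of_factorization VT.
Qed.
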